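(* Let $\mathcal I$ be a left-invariant ccc $\sigma$-ideal with a functionally Borel base on a Baire $K$-analytic topological group $X$ such that $\mathcal{B}o\subseteq\mathcal{B}a^\pm\mathcal I$. For a homomorphism $h:X\to Y$ to a topological group $Y$ the following are equivalent: (1) $h$ is continuous; (2) $h$ is $\mathcal{B}o^\pm\mathcal I$-measurable; (3) $h$ is $\mathcal{B}a^\pm\mathcal I$-measurable; (4) $h$ is $\mathcal A^\curlyvee\mathcal I$-semimeasurable.
   Context: $\mathcal{B}o$ and $\mathcal{B}a$ are the $\sigma$-algebras of Borel and of functionally Borel subsets of $X$ (a set is functionally Borel if it is $f^{-1}[B]$ for a continuous $f:X\to\mathbb R^\omega$ and Borel $B\subseteq\mathbb R^\omega$). A space is Baire if countable intersections of open dense sets are dense. A Tychonoff space is $K$-analytic if it is a continuous image of a Lindelöf Čech-complete space. A $\sigma$-ideal on $X$ is closed under countable unions and subsets with $X=\bigcup\mathcal I$, $X\notin\mathcal I$; left-invariant if $xI\in\mathcal I$ for $I\in\mathcal I$, $x\in X$; has a functionally Borel base if each member lies in a functionally Borel member; is ccc if every family of pairwise disjoint Borel sets not in $\mathcal I$ is countable. $\mathcal A^\pm\mathcal I$ is the $\sigma$-algebra generated by $\mathcal A\cup\mathcal I$; a function is $\mathcal S$-measurable if preimages of open sets lie in $\mathcal S$. A set $M$ is $\mathcal A^\curlyvee\mathcal I$-semimeasurable if for every $K$-analytic $A$ with $A\cap M\notin\mathcal I$ there is a $K$-analytic $B\subseteq A\cap M$ with $B\notin\mathcal I$; a function is $\mathcal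 A^\curlyvee\mathcal I$-semimeasurable if preimages of open sets are. *)

(* Defs.v *)
From HB Require Import structures.
From mathcomp Require Import all_boot all_order all_algebra.
From mathcomp Require Import all_classical all_reals all_analysis.
From mathcomp Require Import Rstruct Rstruct_topology.
From Stdlib Require Import Rdefinitions.

Set Implicit Arguments.
Unset Strict Implicit.
Unset Printing Implicit Defensive.
Local Open Scope classical_set_scope.

Definition is_topgroup (X : topologicalType) (mul : X -> X -> X)
    (inv : X -> X) (one : X) : Prop :=
  [/\ (forall x y z, mul x (mul y z) = mul (mul x y) z),
      (forall x, mul one x = x /\ mul x one = x),
      (forall x, mul (inv x) x = one /\ mul x (inv x) = one),
      continuous (fun p : X * X => mul p.1 p.2) &
      continuous inv].

Definition group_hom (X Y : Type) (mulX : X -> X -> X) (mulY : Y -> Y -> Y)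
  (h : X -> Y) : Prop := forall x y, h (mulX x y) = mulY (h x) (h y).

Definition tychonoff (X : topologicalType) : Prop :=
  hausdorff_space X /\
  forall (x : X) (F : set X), closed F -> ~ F x ->
    exists f : X -> R, continuous f /\ f x = 0%R /\ (forall y, F y -> f y = 1%R).

Definition baire (X : topologicalType) : Prop :=
  forall U : nat -> set X, (forall n, open (U n) /\ dense (U n)) ->
    dense (\bigcap_n U n).

Definition lindelof (Z : topologicalType) : Prop :=
  forall F : set (set Z), (forall U, F U -> open U) ->
    \bigcup_(U in F) U = setT ->
    exists G : set (set Z), [/\ G `<=` F, countable G & \bigcup_(U in G) U = setT].

Definition embedding (Z K : topologicalType) (e : Z -> K) : Prop :=
  [/\ continuous e, injective e &
      forall U : set Z, open U -> exists V : set K, open V /\ e @` U = V `&` range e].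

Definition cech_complete (Z : topologicalType) : Prop :=
  tychonoff Z /\
  exists (K : topologicalType) (e : Z -> K),
    [/\ compact [set: K], hausdorff_space K, embedding e, dense (range e) &
        exists V : nat -> set K, (forall n, open (V n)) /\ range e = \bigcap_n V n].

Definition K_analytic_set (X : topologicalType) (A : set X) : Prop :=
  exists (Z : topologicalType) (f : Z -> X),
    [/\ lindelof Z, cech_complete Z, continuous f & range f = A].

Definition K_analytic (X : topologicalType) : Prop :=
  tychonoff X /\ K_analytic_set [set: X].

Definition borel_sets (T : topologicalType) : set (set T) := <<s open >>.

Definition fborel_sets (X : topologicalType) : set (set X) :=
  [set A | exists (f : X -> {ptws nat -> R}) (B : set {ptws nat -> R}),
     [/\ continuous f, borel_sets B & A = f @^-1` B]].

Definition sigma_ideal (X : Type) (I : set (set X)) : Prop :=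
  [/\ (forall F : nat -> set X, (forall n, I (F n)) -> I (\bigcup_n F n)),
      (forall A B, I B -> A `<=` B -> I A),
      \bigcup_(A in I) A = setT &
      ~ I setT].

Definition left_invariant (X : Type) (mul : X -> X -> X) (I : set (set X)) :=
  forall A x, I A -> I ((fun y => mul x y) @` A).

Definition has_fborel_base (X : topologicalType) (I : set (set X)) :=
  forall A, I A -> exists B, [/\ fborel_sets B, I B & A `<=` B].

Definition ccc_ideal (X : topologicalType) (I : set (set X)) :=
  forall F : set (set X),
    (forall A, F A -> borel_sets A /\ ~ I A) ->
    (forall A B, F A -> F B -> A <> B -> A `&` B = set0) ->
    countable F.

Definition gen_with (X : Type) (A I : set (set X)) : set (set X) := <<s A `|` I >>.

Definition S_measurable (X Y : topologicalType) (S : set (set X)) (h : X -> Y) :=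
  forall U : set Y, open U -> S (h @^-1` U).

Definition semimeasurable_set (X : topologicalType) (I : set (set X)) (M : set X) :=
  forall A : set X, K_analytic_set A -> ~ I (A `&` M) ->
    exists B : set X, [/\ K_analytic_set B, B `<=` A `&` M & ~ I B].

Definition semimeasurable (X Y : topologicalType) (I : set (set X)) (h : X -> Y) :=
  forall U : set Y, open U -> semimeasurable_set I (h @^-1` U).

(* Main.v *)
Require Import Defs.
From mathcomp Require Import all_boot all_order all_algebra.
From mathcomp Require Import all_classical all_reals all_analysis.
From mathcomp Require Import Rstruct Rstruct_topology.
From mathcomp Require wochoice.
From mathcomp Require Import lra.
From Stdlib Require Import Inverse_Image.

(* The heart is that a semimeasurable homomorphism [h] is continuous.
   Steinhaus: if [A] is Souslin and not in the ideal [I], a maximal disjoint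
   family of translates of [A] is countable by the ccc, so countably many
   translates of [A A^-1] cover [X]; as [X] is Baire and Souslin sets have the
   Baire property, [A A^-1 A A^-1] is a neighbourhood of the identity.  It
   remains to see that [h^-1 V] is not in [I] for a neighbourhood [V] of the
   identity.  Otherwise [h^-1 V] lies in a functionally Borel [B] in [I].  Since
   [X] is a Lindelof group, the translate [x B] depends only on a label of [x]
   in the Baire space.  Stone's refinement of the cover by the translates of
   [h^-1 V], indexed by labels, yields a disjoint family of members of [I]
   indexed by labels, all of whose unions are measurable modulo [I], with union
   not in [I].  A Bernstein set of labels gives a contradiction: if the union of
   the sets with labels in [T] is not in [I], a Cantor scheme in a Souslin subset
   of it produces a perfect set of labels inside [T]. *)

Set Implicit Arguments.
Unset Strict Implicit.
Unset Printing Implicit Defensive.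

Local Open Scope classical_set_scope.

(** * Sequences, sigma-ideals, Bernstein sets *)

(** Stone's refinement needs arbitrary unions of its pieces to be measurable modulo the ideal, while
    a Cantor scheme needs the index of a piece to be read off continuously from codes. The
    homomorphism settles the former: any union of translates of [h^-1 W] is again the preimage of an
    open set. Labels settle the latter. They exist because a functionally Borel set is determined by
    countably many continuous real functions, and on a Lindelof group the effect of a translation on
    each of them is controlled, to any given precision, by countably many neighbourhoods of the
    identity. Souslin sets are the common language: in [X] they are exactly the K-analytic sets, and
    they include the functionally Borel ones. The inclusion of the Borel sets in the functionally
    Borel ones modulo [I] makes the Borel hulls supplied by the ccc accessible from inside by
    Souslin sets. *)

Definition agree T n (s s' : nat -> T) := forall i, (i < n)%N -> s i = s' i.

Lemma agree_le T m n (s s' : nat -> T) : (m <= n)%N -> agree n s s' -> agree m s s'.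
Proof. by move=> mn a i im; apply: a; exact: leq_trans im mn. Qed.

Lemma agree_mkseq (T : eqType) n (s s' : nat -> T) :
  agree n s s' <-> mkseq s n = mkseq s' n.
Proof.
split=> [a|ss' i ni]; first by apply/eq_in_map => i; rewrite mem_iota => /a.
by have := congr1 (nth (s i) ^~ i) ss'; rewrite /= !nth_mkseq.
Qed.

Lemma agree_all T (s s' : nat -> T) : (forall n, agree n s s') -> s = s'.
Proof. by move=> a; apply/funext => i; apply: (a i.+1). Qed.

Definition code (i j : nat) : nat := pickle (i, j).

Definition decode (n : nat) : option (nat * nat) := unpickle n.

Lemma codeK i j : decode (code i j) = Some (i, j).
Proof. exact: pickleK. Qed.

(* A point of the Baire space is read as the sequence of its sections [sel i]. *)
Definition sel (i : nat) (s : nat -> nat) : nat -> nat := fun n => s (code i n).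

Definition join (F : nat -> nat -> nat) : nat -> nat :=
  fun m => if decode m is Some p then F p.1 p.2 else 0.

Lemma selK F i : sel i (join F) = F i.
Proof. by apply/funext => n; rewrite /sel /join codeK. Qed.

Lemma agree_sel i n : exists m, forall s s', agree m s s' ->
  agree n (sel i s) (sel i s').
Proof.
exists (\max_(j < n) (code i j).+1) => s s' a j jn; apply: a.
exact: (@leq_bigmax _ (fun k : 'I_n => (code i k).+1)
  (Ordinal jn)).
Qed.

Lemma maximal_disjoint T (P : set (set T)) : exists F : set (set T),
  [/\ F `<=` P, forall A B, F A -> F B -> A <> B -> A `&` B = set0 &
      forall B, P B -> B !=set0 -> exists2 A, F A & A `&` B !=set0].
Proof.
have [F [FP tF maxF]] := ex_maximal_disjoint_subcollection idfun P.
exists F; split => //.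
  move=> A B FA FB AB; apply/eqP/negPn/negP => /set0P AB0.
  exact: AB (tF A B FA FB AB0).
move=> B PB [b Bb]; apply: contrapT => nB.
have nFB : ~ F B by move=> FB; apply: nB; exists B => //; exists b.
apply: (maxF (F `|` [set B])).
- by split=> [|/(_ B (or_intror erefl))//]; exact: subsetUl.
- by move=> A [/FP//|->].
- move=> A C [FA|->] [FC|->] AC //; first exact: tF.
    by exfalso; apply: nB; exists A.
  by exfalso; apply: nB; exists C => //; rewrite setIC.
Qed.

Section sigma_ideals.
Variables (T : Type) (J : set (set T)).

(* Unlike [sigma_ideal], this covers the meager ideal of an arbitrary space. *)
Definition sideal :=
  [/\ J set0, forall A B, J B -> A `<=` B -> J A &
      forall F : nat -> set T, (forall n, J (F n)) -> J (\bigcup_n F n)].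

Hypothesis HJ : sideal.

Lemma sideal_countable K (D : set K) (F : K -> set T) : countable D ->
  (forall i, D i -> J (F i)) -> J (\bigcup_(i in D) F i).
Proof.
have [J0 Jsub JU] := HJ.
move=> /countable_injP[f finj] JF.
apply: (Jsub _ (\bigcup_n [set x | exists i, [/\ D i, f i = n & F i x]])).
  apply: JU => n.
  have [[i [Di fi]]|nD] := pselect (exists i, D i /\ f i = n).
    apply: Jsub (JF i Di) _ => x [j [Dj fj Fjx]].
    suff -> : i = j by [].
    by apply: finj; rewrite ?inE// fi fj.
  by apply: Jsub J0 _ => x [i [Di fi _]]; case: nD; exists i.
by move=> x [i Di Fix]; exists (f i) => //; exists i.
Qed.

Lemma sideal_countType (K : countType) (F : K -> set T) :
  (forall i, J (F i)) -> J (\bigcup_i F i).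
Proof. by move=> JF; apply: sideal_countable. Qed.

Lemma sidealU A B : J A -> J B -> J (A `|` B).
Proof.
have [J0 Jsub JU] := HJ.
move=> JA JB.
apply: (Jsub _ (\bigcup_b (fun b : bool => if b then A else B) b)).
  by apply: sideal_countType => -[].
by move=> x [Ax|Bx]; [exists true|exists false].
Qed.

Lemma sideal_nonempty A : ~ J A -> A !=set0.
Proof.
have [J0 Jsub JU] := HJ.
by move=> nJA; apply/set0P/eqP => A0; apply: nJA; rewrite A0.
Qed.

Lemma sidealD A N : ~ J A -> J N -> ~ J (A `\` N).
Proof.
have [_ Jsub _] := HJ.
move=> nJA JN JAN; apply: nJA; apply: Jsub (sidealU JAN JN) _ => x Ax.
by have [Nx|nNx] := pselect (N x); [right|left].
Qed.

End sigma_ideals.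

(** * Bernstein sets by transfinite recursion over the continuum *)

Section bernstein.
Local Notation E := (nat -> bool).

(** Cardinality less than the continuum, expressed without cardinals. *)
Definition small (S : set E) := ~ exists2 f : E -> E, injective f & range f `<=` S.

Definition merge (x y : E) : E := fun n => if odd n then y n./2 else x n./2.

Lemma merge_inj x y x' y' : merge x y = merge x' y' -> x = x' /\ y = y'.
Proof.
move=> h; split; apply/funext => n.
  by have := congr1 (@^~ n.*2) h; rewrite /merge /= odd_double doubleK.
have := congr1 (@^~ n.*2.+1) h.
by rewrite /merge /= odd_double /= uphalf_double.
Qed.

(* Identify the Cantor space with its square: either [S] contains a row, or [S']
   meets every row. *)
Lemma smallU S S' : small S -> small S' -> small (S `|` S').
Proof.
move=> sS sS' [f finj fS].
have [[x fx]|nx] := pselect (exists x, forall y, S (f (merge x y))).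
  apply: sS; exists (fun y => f (merge x y)); last by move=> _ [y _ <-].
  by move=> y y' /finj/merge_inj[].
have /choice[y Sy] : forall x, exists y, S' (f (merge x y)).
  move=> x; apply: contrapT => ny; apply: nx; exists x => y.
  have [//|S'y] := fS _ (imageT f (merge x y)).
  by case: ny; exists y.
apply: sS'; exists (fun x => f (merge x (y x))); last by move=> _ [x _ <-].
by move=> x x' /finj/merge_inj[].
Qed.

Lemma small_set1 x : small [set x].
Proof.
move=> [f finj fx].
have : f xpredT = f xpred0 by rewrite !(fx _ (imageT f _)).
by move=> /finj/(congr1 (@^~ 0%N)).
Qed.

(** Comparison of cardinalities: [r] allows distinct points of [S] to be chosen for distinct points
    of [S'], so a copy of the Cantor space in [S'] transfers to [S]. *)
Lemma small_rel (S S' : set E) (r : E -> E -> Prop) : small S ->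
  (forall x, S' x -> exists2 y, S y & r x y) ->
  (forall x x' y, r x y -> r x' y -> x = x') -> small S'.
Proof.
move=> sS S'S rinj [f finj fS']; apply: sS.
have /choice[g gP] x : exists y, S y /\ r (f x) y.
  by have [y Sy rxy] := S'S _ (fS' _ (imageT f x)); exists y.
exists g; last by move=> _ [x _ <-]; have [] := gP x.
move=> x x' gg; apply: finj; apply: (rinj _ _ (g x)); first by have [] := gP x.
by rewrite gg; have [] := gP x'.
Qed.

Lemma wf_total (T : choiceType) : exists lt : T -> T -> Prop,
  well_founded lt /\ forall a b, a <> b -> lt a b \/ lt b a.
Proof.
have [R wR] := wochoice.well_ordering_principle T.
have minR (P : set T) : P !=set0 -> exists2 a, P a & forall b, P b -> R a b.
  move=> [x Px]; have [|a [[]]] := wR (fun z => `[< P z >]).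
    by exists x; rewrite unfold_in; apply/asboolP.
  rewrite unfold_in => /asboolP Pa lb _; exists a => // b Pb; apply: lb.
  by rewrite unfold_in; apply/asboolP.
have Ranti a b : R a b -> R b a -> a = b.
  move=> ab ba; have [|c [_ cu]] := wR (pred2 a b).
    by exists a; rewrite !inE eqxx.
  have Raa x : R x x.
    by have [y -> h] := minR [set x] (ex_intro _ x erefl); exact: h.
  rewrite -(cu a) ?(cu b)//.
    split; first by rewrite !inE eqxx orbT.
    by move=> x; rewrite !inE => /orP[] /eqP->.
  split; first by rewrite !inE eqxx.
  by move=> x; rewrite !inE => /orP[] /eqP->.
exists (fun a b => R a b /\ a <> b); split.
  move=> a; apply: contrapT => na.
  have [b nb bmin] := minR (fun z => ~ Acc (fun a b => R a b /\ a <> b) z)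
    (ex_intro _ a na).
  apply: nb; constructor => c [Rcb cb]; apply: contrapT => nc.
  by apply: cb; apply: Ranti => //; exact: bmin.
move=> a b ab; have [c [->|->] h] := minR [set a; b] (ex_intro _ a (or_introl erefl)).
  by left; split => //; apply: h; right.
by right; split; [apply: h; left|exact: nesym].
Qed.

(** Stands in for the initial ordinal of the continuum. If some segment is not small, take the least
    point with such a segment, embed the Cantor space into that segment and pull the order back: the
    new segments inject into segments of earlier points, which are small. *)
Lemma wf_small_segments : exists lt : E -> E -> Prop,
  [/\ well_founded lt, forall a b, a <> b -> lt a b \/ lt b a &
      forall a, small (lt ^~ a)].
Proof.
have [lt [wf tot]] := wf_total E.
have [allsmall|] := pselect (forall a, small (lt ^~ a)); first by exists lt.
move=> /existsNP[a1 na1].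
have [a [/contrapT[f finj fa] amin]] : exists a, ~ small (lt ^~ a) /\
    forall b, lt b a -> small (lt ^~ b).
  elim/(well_founded_ind wf): a1 na1 => a IH na.
  have [h|/existsNP[b /not_implyP[ba nb]]] :=
    pselect (forall b, lt b a -> small (lt ^~ b)); first by exists a.
  exact: IH ba nb.
exists (fun x y => lt (f x) (f y)); split.
- by apply: (@wf_inverse_image _ _ lt f wf).
- by move=> x y xy; apply: tot => /finj.
- move=> x; have sfx := amin _ (fa _ (imageT f x)).
  apply: (small_rel (r := fun y z => f y = z) sfx).
    by move=> y yx; exists (f y).
  by move=> y y' z <- /finj.
Qed.

(** Recursion picks for each [a] two points whose images under [e a] avoid all images picked
    earlier. This is possible because [e a] is injective and fewer than continuum many images have
    been picked. [T] collects the images of the first picks. *)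
Lemma bernstein (O : choiceType) (e : E -> E -> O) : exists T : set O,
  forall a, injective (e a) -> (exists x, T (e a x)) /\ (exists x, ~ T (e a x)).
Proof.
have [lt [wf tot sm]] := wf_small_segments.
pose good a (p : E -> E * E) (uv : E * E) := uv.1 <> uv.2 /\
  forall b, lt b a -> forall w, (w = e b (p b).1 \/ w = e b (p b).2) ->
    e a uv.1 <> w /\ e a uv.2 <> w.
have ex a (p : E -> E * E) : injective (e a) -> exists uv, good a p uv.
  move=> einj.
  pose bad := [set x | exists2 b, lt b a & e a x = e b (p b).1] `|`
     [set x | exists2 b, lt b a & e a x = e b (p b).2].
  have sbad : small bad.
    have sbad (q : E -> E) : small [set x | exists2 b, lt b a & e a x = e b (q b)].
      apply: (small_rel (sm a) (r := fun x b => e a x = e b (q b))) => //.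
      by move=> x x' y xy x'y; apply: einj; rewrite xy x'y.
    by apply: smallU; [exact: (sbad (fun b => (p b).1))|
                       exact: (sbad (fun b => (p b).2))].
  have sNT S : small S -> exists x, ~ S x.
    move=> sS; apply: contrapT => /forallNP h; apply: sS; exists id => //.
    by move=> x _; apply: contrapT; exact: h.
  have [u nu] := sNT _ sbad.
  have [v /not_orP[nv /= vu]] := sNT _ (smallU sbad (small_set1 (x := u))).
  exists (u, v); split=> /=; first exact: nesym.
  move=> b ba w [->|->]; split => h.
  - by apply: nu; left; exists b.
  - by apply: nv; left; exists b.
  - by apply: nu; right; exists b.
  - by apply: nv; right; exists b.
(* The recursion knows only the picks below [a]; elsewhere a dummy pair is used, which [good] never
   inspects. *)
pose F a (rec : forall b, lt b a -> E * E) : E * E :=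
  xget (xpred0, xpred0) (good a (fun b =>
    if pselect (lt b a) is left h then rec b h else (xpred0, xpred0))).
pose p : E -> E * E := Fix wf (fun _ => (E * E)%type) F.
have pE a : injective (e a) -> good a p (p a).
  move=> einj; rewrite {2}/p Fix_eq; last first.
    move=> x f g fg; rewrite /F; congr (xget _ (good _ _)); apply/funext => b.
    by case: pselect.
  rewrite -/p /F.
  pose q b := if pselect (lt b a) is left _ then p b else (xpred0, xpred0).
  rewrite -[xget _ _]/(xget (xpred0, xpred0) (good a q)); case: (xgetP (xpred0, xpred0) (good a q)).
    move=> uv uvE [h1 h2]; split => // b ba w hw; apply: (h2 b) => //.
    by rewrite /q; case: pselect.
  by have [uv guv] := ex a q einj => /(_ uv).
exists [set w | exists a, injective (e a) /\ w = e a (p a).1] => a einj.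
have [auv aP] := pE a einj.
split; first by exists (p a).1, a.
exists (p a).2 => -[b [binj bE]].
have [ab|/tot[]] := pselect (a = b).
- by move: bE; rewrite -ab => /einj/esym.
- move=> ab; have [_ bP] := pE b binj.
  by have [h _] := bP a ab (e a (p a).2) (or_intror erefl); apply: h.
- by move=> ba; have [_] := aP b ba (e b (p b).1) (or_introl erefl).
Qed.

End bernstein.

(** * Souslin sets and upper semicontinuous compact-valued maps *)

Section souslin.
Variable X : topologicalType.

(* Closedness in the product of the Baire space and [X], so that Souslin sets are
   the projections of closed sets. *)
Definition bclosed (D : (nat -> nat) -> set X) := forall s x, ~ D s x ->
  exists n, exists2 U, nbhs x U &
    forall s' x', agree n s s' -> U x' -> ~ D s' x'.

Definition souslin (E : set X) :=
  exists2 D, bclosed D & E = [set x | exists s, D s x].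

Lemma souslin_closed (C : set X) : closed C -> souslin C.
Proof.
move=> cC; exists (fun=> C).
  move=> s x nCx; exists 0, (~` C) => //.
  by apply: open_nbhs_nbhs; split => //; exact: closed_openC.
by apply/seteqP; split=> [x Cx|x [_]//]; exists (fun=> 0).
Qed.

Lemma bclosed_sel i D : bclosed D -> bclosed (fun s => D (sel i s)).
Proof.
move=> cD s x /cD[n [U Ux DU]]; have [m mP] := agree_sel i n.
by exists m, U => // s' x' /mP; exact: DU.
Qed.

Lemma bclosed_bigcap (D : nat -> (nat -> nat) -> set X) :
  (forall i, bclosed (D i)) -> bclosed (fun s => \bigcap_i D i s).
Proof.
move=> cD s x /existsNP[i /not_implyP[_ nD]].
have [n [U Ux DU]] := cD i s x nD.
by exists n, U => // s' x' ss' Ux' /(_ i I); exact: DU ss' Ux'.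
Qed.

(** A single sequence carries the witnesses for all the sets, one in each section. *)
Lemma souslin_bigcap (E : nat -> set X) :
  (forall i, souslin (E i)) -> souslin (\bigcap_i E i).
Proof.
move=> sE; have /choice[D DP] : forall i, exists D, bclosed D /\
    E i = [set x | exists s, D s x].
  by move=> i; have [D cD ->] := sE i; exists D.
exists (fun s => \bigcap_i D i (sel i s)).
  by apply: bclosed_bigcap => i; apply: bclosed_sel; case: (DP i).
apply/seteqP; split=> [x Ex|x [s Ds] i _].
  have /choice[F FP] : forall i, exists s, D i s x.
    by move=> i; have := Ex i I; rewrite (DP i).2.
  by exists (join F) => i _; rewrite selK.
by rewrite (DP i).2; exists (sel i s); exact: Ds.
Qed.

Lemma souslin_bigcup (E : nat -> set X) :
  (forall i, souslin (E i)) -> souslin (\bigcup_i E i).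
Proof.
move=> sE; have /choice[D DP] : forall i, exists D, bclosed D /\
    E i = [set x | exists s, D s x].
  by move=> i; have [D cD ->] := sE i; exists D.
(* The first digit of section 0 is the index of the set, and section 1 is the witness. Agreement up
   to [m0] keeps the index fixed. *)
exists (fun s => D (sel 0 s 0) (sel 1 s)).
  move=> s x nD.
  have cD := (DP (sel 0 s 0)).1.
  have [n [U Ux DU]] := cD _ _ nD.
  have [m mP] := agree_sel 1 n; have [m0 m0P] := agree_sel 0 1.
  exists (maxn m m0), U => // s' x' ss' Ux'.
  rewrite -(m0P s s')//; last exact: agree_le (leq_maxr _ _) ss'.
  by apply: DU => //; apply: mP; exact: agree_le (leq_maxl _ _) ss'.
apply/seteqP; split=> [x [i _]|x [s Ds]].
  rewrite (DP i).2 => -[s Ds].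
  exists (join (fun j => if j == 0 then (fun=> i) else s)).
  by rewrite !selK.
by exists (sel 0 s 0) => //; rewrite (DP _).2; exists (sel 1 s).
Qed.

Lemma souslin_countType (C : countType) (E : C -> set X) :
  (forall i, souslin (E i)) -> souslin (\bigcup_i E i).
Proof.
move=> sE; rewrite (_ : \bigcup_i E i =
  \bigcup_n (if unpickle n is Some i then E i else set0)).
  apply: souslin_bigcup => n; case: unpickle => // ; apply: souslin_closed.
  exact: closed0.
apply/seteqP; split=> [x [i _ Ei]|x [n _]]; first by exists (pickle i); rewrite ?pickleK.
by case: unpickle => // i Ei; exists i.
Qed.

Lemma souslinI (A B : set X) : souslin A -> souslin B -> souslin (A `&` B).
Proof.
move=> sA sB; rewrite (_ : _ `&` _ = \bigcap_i (if i == 0 then A else B)).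
  by apply: souslin_bigcap => i; case: ifP.
apply/seteqP; split=> [x [Ax Bx] i _|x h]; first by case: ifP.
by split; [exact: (h 0)|exact: (h 1)].
Qed.

(* [K] is compact-valued and upper semicontinuous, both at once. *)
Definition usco (K : (nat -> nat) -> set X) := forall s (N : X -> set X),
  (forall x, K s x -> nbhs x (N x)) ->
  exists n, exists2 l : seq X, (forall x, x \in l -> K s x) &
    forall s', agree n s s' -> forall x, K s' x -> exists2 y, y \in l & N y x.

Lemma usco_empty K s : usco K -> K s = set0 ->
  exists n, forall s', agree n s s' -> K s' = set0.
Proof.
move=> uK K0; have [|n [l lK KN]] := uK s (fun=> setT); first by rewrite K0.
exists n => s' ss'; rewrite -subset0 => x /(KN s' ss')[y /lK].
by rewrite K0.
Qed.

(** Upper semicontinuity gives, for each sequence, a finite list that works for all sequences with a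
    common finite prefix. Choosing one list per prefix leaves only countably many points. *)
Lemma usco_countable_cover K (N : X -> set X) : usco K -> \bigcup_s K s = setT ->
  (forall x, nbhs x (N x)) ->
  exists2 C : set X, countable C & forall x, exists2 c, C c & N c x.
Proof.
move=> uK KT Nx.
pose good (t : seq nat) (l : seq X) := forall s, mkseq s (size t) = t ->
  forall x, K s x -> exists2 y, y \in l & N y x.
pose L t := xget [::] (good t).
exists (\bigcup_t [set` L t]).
  apply: bigcup_countable => // t _; exact/finite_set_countable/finite_seq.
move=> x; have [s _ Ksx] : (\bigcup_s K s) x by rewrite KT.
have [n [l lK KN]] := uK s N (fun x _ => Nx x).
pose t := mkseq s n.
have gl : good t l.
  move=> s' ts' y; apply: KN; apply/agree_mkseq; rewrite -/t -ts'.
  by rewrite size_mkseq.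
have gL : good t (L t) by exact: (xgetPex _ (ex_intro _ l gl)).
have [|y yL Ny] := gL s _ x Ksx; first by rewrite size_mkseq.
by exists y => //; exists t.
Qed.

Lemma usco_lindelof K : usco K -> \bigcup_s K s = setT -> lindelof X.
Proof.
move=> uK KT F Fo FT.
have /choice[U UP] : forall x, exists U, F U /\ U x.
  move=> x; have [U FU Ux] : (\bigcup_(U in F) U) x by rewrite FT.
  by exists U.
have [|C cC CU] := usco_countable_cover uK KT (N := U).
  by move=> x; apply: open_nbhs_nbhs; split; [apply: Fo|]; case: (UP x).
exists (U @` C); split.
- by move=> _ [x _ <-]; case: (UP x).
- exact: sub_countable (card_image_le _ _) cC.
- apply/seteqP; split => // x _; have [c Cc Ucx] := CU x.
  by exists (U c) => //; exists c.
Qed.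

Lemma nbhs_seq (T : eqType) (l : seq T) (V : T -> set X) (x : X) :
  (forall y, y \in l -> nbhs x (V y)) ->
  nbhs x [set z | forall y, y \in l -> V y z].
Proof.
elim: l => [|a l IH] h; first by apply: filterS filterT => z.
have : nbhs x (V a `&` [set z | forall y, y \in l -> V y z]).
  apply: filterI; first by apply: h; rewrite mem_head.
  by apply: IH => y yl; apply: h; rewrite inE yl orbT.
by apply: filterS => z [Va Vl] y; rewrite inE => /orP[/eqP->//|/Vl].
Qed.

Lemma usco_bclosed K : hausdorff_space X -> usco K -> bclosed K.
Proof.
rewrite open_hausdorff => hX uK s x nKx.
have /choice[UV UVP] : forall y, exists UV : set X * set X, K s y ->
    [/\ nbhs y UV.1, nbhs x UV.2 & UV.1 `&` UV.2 = set0].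
  move=> y; have [Ky|nKy] := pselect (K s y); last by exists (setT, setT).
  have yx : y != x by apply/eqP => yx; apply: nKx; rewrite -yx.
  have [UV [/set_mem yU /set_mem xV] [oU oV /eqP UV0]] := hX y x yx.
  by exists UV => _; split => //; exact: open_nbhs_nbhs.
have [|n [l lK KN]] := uK s (fun y => (UV y).1); first by move=> y /UVP[].
exists n, [set z | forall y, y \in l -> (UV y).2 z].
  by apply: nbhs_seq => y /lK/UVP[].
move=> s' x' ss' hx' /(KN s' ss')[y yl U1].
have [_ _ UV0] := UVP y (lK y yl).
have : ((UV y).1 `&` (UV y).2) x' by split => //; exact: hx'.
by rewrite UV0.
Qed.

Lemma seq_bound (T : eqType) (l : seq T) (n : T -> nat) :
  exists m, forall x, x \in l -> (n x <= m)%N.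
Proof.
elim: l => [|a l [m mP]]; first by exists 0.
exists (maxn (n a) m) => x; rewrite inE => /orP[/eqP->|/mP h].
  exact: leq_maxl.
exact: leq_trans h (leq_maxr _ _).
Qed.

(** Points of the compact value outside [D] get neighbourhoods that witness this; in the finite
    subcover they are discarded once enough digits agree. *)
Lemma usco_bclosedI K D : usco K -> bclosed D ->
  usco (fun s => K (sel 0 s) `&` D (sel 1 s)).
Proof.
move=> uK cD s N NP.
have /choice[nU nUP] : forall x, exists nU : nat * set X,
    ~ D (sel 1 s) x -> nbhs x nU.2 /\ forall s' x', agree nU.1 (sel 1 s) s' ->
      nU.2 x' -> ~ D s' x'.
  move=> x; have [Dx|nDx] := pselect (D (sel 1 s) x); first by exists (0, setT).
  by have [n [U Ux UD]] := cD _ _ nDx; exists (n, U).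
pose N' x := if pselect (D (sel 1 s) x) then N x else (nU x).2.
have [|n [l lK KN]] := uK (sel 0 s) N'.
  move=> x Kx; rewrite /N'; case: pselect => [Dx|/nUP[]//].
  exact: NP.
have [m mP] := seq_bound l (fun x => (nU x).1).
have [n0 n0P] := agree_sel 0 n; have [n1 n1P] := agree_sel 1 m.
exists (maxn n0 n1), [seq x <- l | `[< D (sel 1 s) x >]].
  by move=> x; rewrite mem_filter => /andP[/asboolP Dx /lK].
move=> s' ss' x [Kx Dx].
have [||y yl] := KN (sel 0 s') _ x; rewrite ?/N' //.
  by apply: n0P; exact: agree_le (leq_maxl _ _) ss'.
case: pselect => [Dy Ny|nDy Uyx].
  by exists y => //; rewrite mem_filter yl andbT; apply/asboolP.
exfalso; have [_ yU] := nUP y nDy; apply: yU Uyx Dx; apply: agree_le (mP _ yl) _.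
by apply: n1P; exact: agree_le (leq_maxr _ _) ss'.
Qed.

Lemma usco_souslin K : hausdorff_space X -> usco K -> souslin (\bigcup_s K s).
Proof.
move=> hX uK; exists K; first exact: usco_bclosed.
by apply/seteqP; split=> x [s]; [move=> _ ?|]; exists s.
Qed.

End souslin.

Lemma souslin_preimage (X Y : topologicalType) (f : X -> Y) (E : set Y) :
  continuous f -> souslin E -> souslin (f @^-1` E).
Proof.
move=> cf [D cD ->]; exists (fun s => f @^-1` D s) => //.
move=> s x /cD[n [U Ux UD]]; exists n, (f @^-1` U); first exact: cf.
by move=> s' x' ss' /UD; exact.
Qed.

(** The tube argument: a finite list in [Y] for every point of [K], then a finite list of such
    points. *)
Lemma usco_image2 (X Y Z : topologicalType) (K : (nat -> nat) -> set X)
    (L : (nat -> nat) -> set Y) (f : X * Y -> Z) : continuous f ->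
  usco K -> usco L ->
  usco (fun s => [set f (x, y) | x in K (sel 0 s) & y in L (sel 1 s)]).
Proof.
move=> cf uK uL s N NP.
have /choice[W WP] : forall p : X * Y, exists W : set X * set Y,
    K (sel 0 s) p.1 -> L (sel 1 s) p.2 ->
    [/\ nbhs p.1 W.1, nbhs p.2 W.2 & forall x y, W.1 x -> W.2 y -> N (f p) (f (x, y))].
  move=> [x y] /=.
  have [[Kx Ly]|nKL] := pselect (K (sel 0 s) x /\ L (sel 1 s) y); last first.
    by exists (setT, setT) => Kx Ly; case: nKL.
  have /cf[/= W [W1 W2] WN] : nbhs (f (x, y)) (N (f (x, y))).
    by apply: NP; exists x => //; exists y.
  by exists W => _ _; split => // x' y' W1x' W2y'; exact: (WN (x', y')).
have /choice[q qP] : forall x, exists q : nat * seq Y, K (sel 0 s) x ->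
    (forall y, y \in q.2 -> L (sel 1 s) y) /\ forall s', agree q.1 (sel 1 s) s' ->
      forall y, L s' y -> exists2 y', y' \in q.2 & (W (x, y')).2 y.
  move=> x; have [Kx|nKx] := pselect (K (sel 0 s) x); last by exists (0, [::]).
  have [|n [l lL LN]] := uL (sel 1 s) (fun y => (W (x, y)).2).
    by move=> y Ly; have [] := WP (x, y) Kx Ly.
  by exists (n, l).
have [|n [l lK KN]] := uK (sel 0 s)
    (fun x => [set z | forall y, y \in (q x).2 -> (W (x, y)).1 z]).
  move=> x Kx; apply: nbhs_seq => y yq.
  by have [] := WP (x, y) Kx ((qP x Kx).1 y yq).
have [m mP] := seq_bound l (fun x => (q x).1).
have [n0 n0P] := agree_sel 0 n; have [n1 n1P] := agree_sel 1 m.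
exists (maxn n0 n1), (flatten [seq [seq f (x, y) | y <- (q x).2] | x <- l]).
  move=> z /flatten_mapP[x xl /mapP[y yq ->]].
  by exists x; [exact: lK|exists y => //; apply: (qP x (lK x xl)).1].
move=> s' ss' _ [x Kx [y Ly <-]].
have [||x' x'l Wx] := KN (sel 0 s') _ x; rewrite //.
  by apply: n0P; exact: agree_le (leq_maxl _ _) ss'.
have Kx' := lK _ x'l.
have [|y' y'q Wy] := (qP x' Kx').2 (sel 1 s') _ y Ly.
  apply: agree_le (mP _ x'l) _.
  by apply: n1P; exact: agree_le (leq_maxr _ _) ss'.
exists (f (x', y')).
  apply/flatten_mapP; exists x' => //; exact: map_f.
have [_ _] := WP (x', y') Kx' ((qP x' Kx').1 _ y'q); apply => //.
exact: Wx.
Qed.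

(** The sets containing a box with finitely many constraints form a filter, and it converges to [x]
    because each coordinate converges. *)
Lemma ptws_nbhs (T : topologicalType) (x : {ptws nat -> T}) (U : set {ptws nat -> T}) :
  nbhs x U -> exists n, exists2 N : nat -> set T, (forall i, nbhs (x i) (N i)) &
    [set y : {ptws nat -> T} | forall i, (i < n)%N -> N i (y i)] `<=` U.
Proof.
pose F : set_system {ptws nat -> T} := fun U => exists n,
  exists2 N : nat -> set T, (forall i, nbhs (x i) (N i)) &
    [set y : {ptws nat -> T} | forall i, (i < n)%N -> N i (y i)] `<=` U.
have FF : Filter F.
  split.
  - by exists 0, (fun=> setT) => // i; exact: filterT.
  - move=> A B [n [N Nx NA]] [n' [N' N'x N'B]].
    exists (maxn n n'), (fun i => N i `&` N' i); first by move=> i; exact: filterI.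
    move=> y Ny; split; [apply: NA|apply: N'B] => i ni.
      by have [] := Ny i (leq_trans ni (leq_maxl _ _)).
    by have [] := Ny i (leq_trans ni (leq_maxr _ _)).
  - by move=> A B AB [n [N Nx NA]]; exists n, N => //; exact: subset_trans NA AB.
suff : F --> x by move=> h; exact: h.
apply/cvg_sup => i V [B [[C oC <-] Cx] CV].
rewrite nbhs_filterE; exists i.+1, (fun j => if j == i then C else setT).
  move=> j; case: eqP => [->|_]; last exact: filterT.
  exact: open_nbhs_nbhs.
by move=> y Ny; apply: CV; have := Ny i (ltnSn i); rewrite eqxx.
Qed.

(** The sets that are Souslin together with their complements form a sigma-algebra, whereas Souslin
    sets alone are not closed under complements. *)
Lemma sigma_souslin (Y : topologicalType) :
  (forall U : set Y, open U -> souslin U) -> borel_sets (T := Y) `<=` @souslin Y.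
Proof.
move=> so B /(_ [set B | souslin B /\ souslin (~` B)]) [] //; split.
  split=> /=; rewrite ?setC0; first by split; apply: souslin_closed; [exact: closed0|exact: closedT].
    by move=> A [sA sAC]; rewrite setTD setCK.
  move=> A h; split; first by apply: souslin_bigcup => i; case: (h i).
  by rewrite setC_bigcup; apply: souslin_bigcap => i; case: (h i).
by move=> U oU; split; [exact: so|apply: souslin_closed; exact: open_closedC].
Qed.

(** * Functionally Borel sets are Souslin *)

Section ptws_real.
Import Order.TTheory GRing.Theory Num.Theory.
Import numFieldNormedType.Exports.
Local Open Scope ring_scope.
Local Notation R := Rdefinitions.R.

Let near_box (F : realFieldType) (x r k : F) : x - k < r -> r < x + k ->
  r - k <= x <= r + k.
Proof. by move=> a b; apply/andP; split; lra. Qed.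

Let box_near (F : realFieldType) (x y r k : F) : x - k < r -> r < x + k ->
  r - k <= y -> y <= r + k -> `|x - y| < k + k.
Proof. by move=> a b c d; rewrite ltr_norml; apply/andP; split; lra. Qed.

(** An open set is the countable union of the closed boxes inside it that have rational centres and
    radius [1/(k+1)] in finitely many coordinates. *)
Lemma ptws_open_souslin (U : set {ptws nat -> R}) : open U -> souslin U.
Proof.
move=> oU.
pose box (p : seq rat * nat) : set {ptws nat -> R} := \bigcap_i
  (if (i < size p.1)%N then
    (fun x : {ptws nat -> R} => x i) @^-1`
      `[ratr (nth 0 p.1 i) - p.2.+1%:R^-1, ratr (nth 0 p.1 i) + p.2.+1%:R^-1]
  else setT).
have sbox p : souslin (box p).
  apply: souslin_bigcap => i; case: ifP => _.
    apply: souslin_preimage; first exact: (@proj_continuous nat (fun=> R) i).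
    by apply: souslin_closed; exact: interval_closed.
  by apply: souslin_closed; exact: closedT.
rewrite (_ : U = \bigcup_p (if pselect (box p `<=` U) then box p else set0)).
  apply: souslin_countType => p; case: pselect => [pU|npU]; first exact: sbox.
  by apply: souslin_closed; exact: closed0.
apply/seteqP; split=> [x Ux|x [p _]]; last by case: pselect => // h /h.
have [n [N Nx NU]] := ptws_nbhs (open_nbhs_nbhs (conj oU Ux)).
have /choice[e eP] : forall i, exists e : R, 0 < e /\ ball (x i) e `<=` N i.
  by move=> i; have /nbhs_ballP[e /= e0 eN] := Nx i; exists e.
(* Both the distance from [x i] to the centre and the radius of the box are at most [1/(k+1)], so
   half of [e i] is the right bound. *)
have [k kP] : exists k, forall i, (i < n)%N -> (k.+1%:R^-1 : R) < e i / 2.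
  elim: (n) => [|m [k kP]]; first by exists 0%N.
  have e0 : 0 < e m / 2 by rewrite divr_gt0//; case: (eP m).
  have [k' _ k'P] := near_infty_natSinv_lt (PosNum e0).
  exists (maxn k k') => i; rewrite ltnS leq_eqVlt => /orP[/eqP->|im].
    exact: (k'P _ (leq_maxr k k')).
  apply: le_lt_trans (kP i im); rewrite lef_pV2 ?posrE// ler_nat ltnS.
  exact: leq_maxl.
have /choice[r rP] : forall i, exists r : rat,
    x i - k.+1%:R^-1 < ratr r /\ ratr r < x i + k.+1%:R^-1.
  move=> i; have [|r] := @rat_in_itvoo R (x i - k.+1%:R^-1) (x i + k.+1%:R^-1).
    by rewrite ltrD2l (@lt_trans _ _ 0)// ?oppr_lt0.
  by rewrite in_itv /= => /andP[a b]; exists r.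
exists (mkseq r n, k) => //; case: pselect => [boxU|[]].
  move=> i _ /=; rewrite size_mkseq; case: ifP => // ni.
  rewrite nth_mkseq//= in_itv /=; have [a b] := rP i.
  exact: near_box a b.
move=> y /= yb; apply: NU => i ni; apply: (eP i).2.
have := yb i Logic.I; rewrite size_mkseq ni nth_mkseq//= in_itv /= => /andP[ya yb'].
have [ra rb] := rP i; apply: lt_trans (_ : k.+1%:R^-1 + k.+1%:R^-1 < _); last first.
  by rewrite [ltRHS]splitr ltrD// kP.
exact: (box_near ra rb ya yb').
Qed.

Lemma fborel_souslin (X : topologicalType) : @fborel_sets X `<=` @souslin X.
Proof.
move=> _ [f [B [cf bB ->]]]; apply: souslin_preimage => //.
exact: (sigma_souslin ptws_open_souslin).
Qed.

End ptws_real.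

(** * K-analytic sets are Souslin, and conversely *)

(** Otherwise the complements of finite unions of the [N x] generate a proper filter on [A]; at a
    cluster point [p], the set [N p] would meet its own complement. *)
Lemma compact_seq_cover (T : topologicalType) (A : set T) (N : T -> set T) :
  compact A -> (forall x, A x -> nbhs x (N x)) ->
  exists2 l : seq T, (forall x, x \in l -> A x) &
    forall y, A y -> exists2 x, x \in l & N x y.
Proof.
move=> cA NP; apply: contrapT => nl.
pose F : set_system T := fun U => exists2 l : seq T, (forall x, x \in l -> A x) &
  forall y, A y -> (forall x, x \in l -> ~ N x y) -> U y.
have FF : ProperFilter F.
  split.
    move=> [l lA lF]; apply: nl; exists l => // y Ay; apply: contrapT => ny.
    by apply: (lF y Ay) => x xl Nxy; apply: ny; exists x.
  split.
  - by exists [::].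
  - move=> U V [l lA lU] [l' l'A l'V]; exists (l ++ l').
      by move=> x; rewrite mem_cat => /orP[/lA|/l'A].
    move=> y Ay h; split; [apply: lU|apply: l'V] => // x xl; apply: h;
      by rewrite mem_cat xl ?orbT.
  - by move=> U V UV [l lA lU]; exists l => // y Ay /(lU y Ay)/UV.
have FA : F A by exists [::].
have [p [Ap clp]] := cA F FF FA.
have [] := clp (~` N p) (N p).
- exists [:: p]; first by move=> x; rewrite inE => /eqP->.
  by move=> y Ay; apply; rewrite mem_head.
- exact: NP.
- by move=> x [].
Qed.

Lemma hausdorff_injective (S T : topologicalType) (f : S -> T) :
  hausdorff_space T -> continuous f -> injective f -> hausdorff_space S.
Proof.
move=> hT cf finj p q clpq; apply: finj; apply: hT => A B Ap Bq.
have [x [Ax Bx]] := clpq _ _ (cf _ _ Ap) (cf _ _ Bq).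
by exists (f x).
Qed.

Lemma hausdorff_prod (U V : topologicalType) :
  hausdorff_space U -> hausdorff_space V -> hausdorff_space (U * V)%type.
Proof.
move=> hU hV [p1 p2] [q1 q2] cl; congr pair.
  apply: hU => A B Ap Bq.
  have [||[x y] [/= Ax Bx]] := cl (fst @^-1` A) (fst @^-1` B); last by exists x.
    exact: (cvg_fst (F := nbhs p1) (G := nbhs p2)).
  exact: (cvg_fst (F := nbhs q1) (G := nbhs q2)).
apply: hV => A B Ap Bq.
have [||[x y] [/= Ax Bx]] := cl (snd @^-1` A) (snd @^-1` B); last by exists y.
  exact: (cvg_snd (F := nbhs p1) (G := nbhs p2)).
exact: (cvg_snd (F := nbhs q1) (G := nbhs q2)).
Qed.

Lemma tychonoff_compact (T : topologicalType) :
  hausdorff_space T -> compact [set: T] -> Defs.tychonoff T.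
Proof.
move=> hT cT; split => // x F cF nFx.
have nT : normal_space T by exact: compact_normal.
have := normal_completely_regular nT (hausdorff_accessible hT) cF nFx.
move=> /(_ Rdefinitions.R)/(@uniform_separatorP _ Rdefinitions.R)[f [cf _ f0 f1]].
exists f; split => //; split; first by apply: f0; exists x.
by move=> y Fy; apply: f1; exists y.
Qed.

Lemma open_setX (U V : topologicalType) (A : set U) (B : set V) :
  open A -> open B -> open (A `*` B).
Proof.
by move=> oA oB; rewrite openE => -[a b] [/= Aa Bb]; exists (A, B) => //; split;
  exact: open_nbhs_nbhs.
Qed.

Section initial.
Variables (S : choiceType) (T : topologicalType) (f : S -> T).
Local Notation W := (initial_topology f).

Lemma initial_nbhs (w : W) (A : set W) : nbhs w A ->
  exists2 B : set T, nbhs (f w) B & f @^-1` B `<=` A.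
Proof.
by move=> [_ [[B oB <-] Bw] BA]; exists B => //; exact: open_nbhs_nbhs.
Qed.

Lemma tychonoff_initial : injective f -> Defs.tychonoff T -> Defs.tychonoff W.
Proof.
move=> finj [hT tT]; split.
  exact: (@hausdorff_injective W T f hT (@initial_continuous _ _ f)).
move=> x F cF nFx.
have [B oB BF] : open (~` F) by exact: closed_openC.
have Bx : B (f x) by rewrite -[B (f x)]/((f @^-1` B) x) BF.
have [|g [cg [g0 g1]]] := tT (f x) (~` B) (open_closedC oB); first by apply.
exists (g \o f); split; last split => //.
  move=> w; apply: continuous_comp; first exact: (@initial_continuous _ _ f).
  exact: cg.
move=> y Fy; apply: g1 => By.
have : (f @^-1` B) y by [].
by rewrite BF.
Qed.

End initial.

Lemma compact_initial_closed (T : topologicalType) (A : set T) :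
  compact [set: T] -> closed A -> compact [set: initial_topology (val : A -> T)].
Proof.
move=> cT cA F FF _.
have cA' : compact A by exact: subclosed_compact cA cT (@subsetT _ _).
have [|p [Ap clp]] := cA' (val @ F) (fmap_proper_filter _ FF).
  have -> : (val @ F) A = F setT.
    rewrite /fmap /=; congr F; apply/seteqP; split=> // z _.
    exact: set_mem (valP z).
  exact: filterT.
have pA : p \in A by exact: mem_set.
exists (SigSub pA) => //; split => // U V FU /initial_nbhs[B Bp BV].
have [] := clp (val @` U) B.
- by rewrite /fmap /=; apply: (@filterS _ F _ U) => // z Uz; exists z.
- exact: Bp.
- by move=> _ [[z Uz <-] Bz]; exists z; split => //; exact: BV.
Qed.

(** By regularity of the compactification and the Lindelof property, each [V n] contains countably
    many closed sets [C n k] covering the image of [Z]. The value at [s] is the intersection of the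
    [C n (s n)]: closed in a compact space, and inside the image of [Z] because that is the
    intersection of the [V n]. *)
Lemma cech_usco (Z : topologicalType) : lindelof Z -> cech_complete Z ->
  exists2 K : (nat -> nat) -> set Z, usco K & \bigcup_s K s = setT.
Proof.
move=> lZ [_ [T [e [cT hT [ce einj eo] _ [V [oV eV]]]]]].
have VE z n : V n (e z).
  have : range e (e z) by exists z.
  by rewrite eV; exact.
have regT z n : exists2 W, nbhs (e z) W & closure W `<=` V n.
  apply: (compact_regular hT cT) => //; first exact: filterT.
  by apply: open_nbhs_nbhs; split.
have /choice[C CP] : forall n, exists C : nat -> set T,
    (forall k, closed (C k) /\ C k `<=` V n) /\ forall z, exists k, C k (e z).
  move=> n.
  have /choice[W WP] : forall z, exists W, nbhs (e z) W /\ closure W `<=` V n.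
    by move=> z; have [W] := regT z n; exists W.
  have [||G [GF cG GT]] := lZ [set U | exists z, U = e @^-1` (interior (W z))].
  - move=> _ [z ->]; apply: open_comp => //; exact: open_interior.
  - apply/seteqP; split => // z _; exists (e @^-1` (interior (W z))).
      by exists z.
    by have [Wz _] := WP z.
  have [g ginj] := countable_injP _ cG.
  have /choice[C CP] : forall k, exists C : set T, (closed C /\ C `<=` V n) /\
      forall U, G U -> g U = k -> U `<=` e @^-1` C.
    move=> k; have [[U [GU gU]]|nU] := pselect (exists U, G U /\ g U = k); last first.
      exists set0; split; first by split => //; exact: closed0.
      by move=> U GU gU; case: nU; exists U.
    have [z Uz] := GF _ GU.
    exists (closure (W z)); split.
      by split; [exact: closed_closure|case: (WP z)].
    move=> U' GU' gU'; have -> : U' = U by apply: ginj; rewrite ?inE// gU.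
    by rewrite Uz => z' /interior_subset/subset_closure.
  exists C; split; first by move=> k; case: (CP k).
  move=> z; have [U GU Uz] : (\bigcup_(U in G) U) z by rewrite GT.
  by exists (g U); apply: (CP (g U)).2 GU erefl _ Uz.
exists (fun s => [set z | forall n, C n (s n) (e z)]); last first.
  apply/seteqP; split=> // z _.
  have /choice[s sP] : forall n, exists k, C n k (e z).
    by move=> n; case: (CP n).
  by exists s.
move=> s N NP.
(* [Some z] marks a point [k = e z] of the value at [s]; [None] marks a point outside it, together
   with an index [n] and a neighbourhood missing [C n (s n)]. *)
pose ok (k : T) (q : set T * nat * option Z) := nbhs k q.1.1 /\
  if q.2 is Some z then (forall n, C n (s n) (e z)) /\
    forall z', q.1.1 (e z') -> N z z'
  else forall k', q.1.1 k' -> ~ C q.1.2 (s q.1.2) k'.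
have /choice[q qP] : forall k, exists q, ok k q.
  move=> k; have [kC|/existsNP[n nC]] := pselect (forall n, C n (s n) k); last first.
    exists (~` C n (s n), n, None); split => //.
    apply: open_nbhs_nbhs; split => //; apply: closed_openC.
    by case: ((CP n).1 (s n)).
  have [z _ ez] : range e k.
    by rewrite eV => n _; apply: ((CP n).1 (s n)).2.
  rewrite -ez in kC *.
  have := NP z kC; rewrite nbhsE => -[U [oU Uz] UN].
  have [B [oB BU]] := eo U oU.
  exists (B, 0, Some z); split => /=.
    apply: open_nbhs_nbhs; split => //.
    have : (e @` U) (e z) by exists z.
    by rewrite BU => -[].
  split => // z' Bz'; apply: UN.
  have : (e @` U) (e z') by rewrite BU; split => //; exists z'.
  by move=> [z'' Uz'' /einj <-].
have [l _ lP] := compact_seq_cover (N := fun k => (q k).1.1) cT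
  (fun k _ => (qP k).1).
have [m mP] := seq_bound l (fun k => (q k).1.2).
(* The digits up to and including [m] must agree, since an excluding index may equal [m]. *)
exists m.+1, (pmap (fun k => (q k).2) l).
  move=> z; rewrite mem_pmap => /mapP[k kl kz].
  by have [_] := qP k; rewrite -kz => -[].
move=> s' ss' z Cz; have [k kl qk] := lP (e z) I.
have [_] := qP k; case E : (q k).2 => [z'|].
  move=> [_ /(_ z qk) Nz]; exists z' => //.
  by rewrite mem_pmap; apply/mapP; exists k.
move=> /(_ _ qk) []; rewrite ss'; first exact: Cz.
by rewrite ltnS; exact: mP.
Qed.

Lemma usco_image (X Y : topologicalType) (K : (nat -> nat) -> set X) (f : X -> Y) :
  continuous f -> usco K -> usco (fun s => f @` K s).
Proof.
move=> cf uK s N NP.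
have [|n [l lK lP]] := uK s (fun x => f @^-1` N (f x)); last first.
  exists n, (map f l); first by move=> _ /mapP[x /lK Kx ->]; exists x.
  move=> s' ss' _ [x Kx <-]; have [y yl Ny] := lP s' ss' x Kx.
  by exists (f y) => //; exact: map_f.
by move=> x Kx; apply: cf; apply: NP; exists x.
Qed.

Lemma K_analytic_usco (X : topologicalType) (A : set X) : K_analytic_set A ->
  exists2 K : (nat -> nat) -> set X, usco K & \bigcup_s K s = A.
Proof.
move=> [Z [f [lZ cZ cf <-]]]; have [K uK KT] := cech_usco lZ cZ.
exists (fun s => f @` K s); first exact: usco_image.
apply/seteqP; split=> [_ [s _ [z _ <-]]|_ [z _ <-]]; first by exists z.
have [s _ Ksz] : (\bigcup_s K s) z by rewrite KT.
by exists s => //; exists z.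
Qed.

Lemma K_analytic_souslin (X : topologicalType) (A : set X) : hausdorff_space X ->
  K_analytic_set A -> souslin A.
Proof.
by move=> hX /K_analytic_usco[K uK <-]; exact: usco_souslin.
Qed.

(** * Souslin subsets of a K-analytic space are K-analytic *)

Section souslin_K_analytic.

(* Through graphs the Baire space becomes a G_delta subset of the Cantor space. *)
Definition graph (r : nat -> nat) : cantor_space :=
  fun p => `[< exists i, p = code i (r i) >].

Lemma graphP r i j : graph r (code i j) = true <-> r i = j.
Proof.
split=> [/asboolP[i' /(congr1 decode)]|<-]; last by apply/asboolP; exists i.
by rewrite !codeK => -[-> ->].
Qed.

Lemma graph_inj : injective graph.
Proof.
move=> r r' rr'; apply/funext => i; apply/esym/graphP; rewrite -rr'.
exact/graphP.
Qed.

Lemma graph_agree r (U : set cantor_space) : nbhs (graph r) U ->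
  exists n, forall r', agree n r r' -> U (graph r').
Proof.
move=> /ptws_nbhs[n [N Nr NU]].
pose bound p := if decode p is Some ij then ij.1.+1 else 0.
exists (\max_(p < n) bound p) => r' rr'; apply: NU => p pn.
suff -> : graph r' p = graph r p by exact: nbhs_singleton.
have rr i j : p = code i j -> r i = r' i.
  move=> pE; apply: rr'; apply: (@leq_trans (bound p)).
    by rewrite /bound pE codeK.
  exact: (@leq_bigmax _ (fun k : 'I_n => bound k) (Ordinal pn)).
apply/idP/idP => /asboolP[i pE]; apply/asboolP; exists i.
  by rewrite (rr _ _ pE).
by rewrite -(rr _ _ pE).
Qed.

Lemma nbhs_bit (a : cantor_space) p : a p = true ->
  nbhs a [set a' : cantor_space | a' p = true].
Proof.
move=> ap; apply: (@proj_continuous nat (fun=> bool) p a [set true]).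
by apply: open_nbhs_nbhs; split; [exact: discrete_open|].
Qed.

Lemma nbhs_graph r n : nbhs (graph r)
  [set a | forall i, (i < n)%N -> a (code i (r i)) = true].
Proof.
elim: n => [|n IH]; first by apply: filterS filterT => a.
have /(filterI IH) : nbhs (graph r) [set a | a (code n (r n)) = true].
  by apply: nbhs_bit; exact/graphP.
apply: filterS => a [h1 h2] i; rewrite ltnS leq_eqVlt => /orP[/eqP->//|].
exact: h1.
Qed.

Variables (X Z0 : topologicalType) (f : Z0 -> X) (D : (nat -> nat) -> set X).
Hypotheses (lZ : lindelof Z0) (cZ : cech_complete Z0) (cf : continuous f).
Hypothesis cD : bclosed D.

(** The pairs [(s, z)] with [D s (f z)] map onto this set. Embedded by [eps] in the compact product
    of the Cantor space and [K0], they form a space that is Lindelof by a usco parametrisation, and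
    a G_delta set in its closure, hence Cech-complete. *)
Lemma souslin_K_analytic_image :
  K_analytic_set [set x | range f x /\ exists s, D s x].
Proof.
have [_ [K0 [e [cK hK [ce einj eo] _ [V [oV eV]]]]]] := cZ.
pose B : set ((nat -> nat) * Z0) := [set p | D p.1 (f p.2)].
pose eps (p : B) : cantor_space * K0 := (graph (val p).1, e (val p).2).
pose Z := initial_topology eps.
have epsinj : injective eps.
  move=> p q [/graph_inj h1 /einj h2]; apply: val_inj.
  by rewrite (surjective_pairing (val p)) h1 h2 -surjective_pairing.
have hCK : hausdorff_space (cantor_space * K0)%type.
  exact: hausdorff_prod cantor_space_hausdorff hK.
have cCK : compact [set: cantor_space * K0].
  by rewrite -setXTT; exact: compact_setX cantor_space_compact cK.
have Znbhs (p : Z) (U : set Z) : nbhs p U -> exists n, exists2 O : set Z0,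
    nbhs (val p).2 O & forall q : Z, agree n (val p).1 (val q).1 ->
      O (val q).2 -> U q.
  move=> /initial_nbhs[W [[/= W1 W2] [/= W1p W2p] W12] WU].
  have [n nP] := graph_agree W1p.
  exists n, (e @^-1` W2); first exact: ce.
  move=> q pq W2q; apply: WU; apply: (W12 (graph _, e _)); split => //=.
  exact: nP.
have [K uK KT] := cech_usco lZ cZ.
have uscoZ : usco (fun s => [set p : Z | (val p).1 = sel 1 s /\ K (sel 0 s) (val p).2]).
  move=> s N NP; set r := sel 1 s in NP *.
  (* [Some p] marks a [z] that is the second coordinate of a point [p] of [Z] over [r]; [None] marks
     a [z] near which no such points exist. For [z] outside the compact value the first case demands
     nothing of the neighbourhood. *)
  pose ok z (w : nat * set Z0 * option Z) := nbhs z w.1.2 /\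
    if w.2 is Some p then [/\ (val p).1 = r, (val p).2 = z &
      K (sel 0 s) z -> forall q : Z, agree w.1.1 r (val q).1 -> w.1.2 (val q).2 -> N p q]
    else forall q : Z, agree w.1.1 r (val q).1 -> ~ w.1.2 (val q).2.
  have /choice[w wP] : forall z, exists w, ok z w.
    move=> z; have [Dz|/cD[n [U Uz UD]]] := pselect (D r (f z)); last first.
      exists (n, f @^-1` U, None); split; first exact: cf.
      move=> q rq Uq; apply: (UD _ _ rq Uq).
      exact: set_mem (valP q).
    have Bp : (r, z) \in B by exact: mem_set.
    pose p : Z := SigSub Bp.
    have [Kz|nKz] := pselect (K (sel 0 s) z); last first.
      by exists (0, setT, Some p); split; [exact: filterT|].
    have [n [U Uz UN]] := Znbhs p (N p) (NP p (conj erefl Kz)).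
    by exists (n, U, Some p).
  have [|n [l lK lP]] := uK (sel 0 s) (fun z => (w z).1.2).
    by move=> z _; case: (wP z).
  have [m mP] := seq_bound l (fun z => (w z).1.1).
  have [n0 n0P] := agree_sel 0 n; have [n1 n1P] := agree_sel 1 m.
  exists (maxn n0 n1), (pmap (fun z => (w z).2) l).
    move=> p; rewrite mem_pmap => /mapP[z zl pE]; have := wP z.
    by rewrite /ok -pE => -[_ [/= -> -> _]]; split => //; exact: lK.
  move=> s' ss' q [qr Kq].
  have [|z zl zq] := lP (sel 0 s') _ _ Kq.
    by apply: n0P; exact: agree_le (leq_maxl _ _) ss'.
  have rq : agree (w z).1.1 r (val q).1.
    rewrite qr; apply: agree_le (mP _ zl) _; apply: n1P.
    exact: agree_le (leq_maxr _ _) ss'.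
  have [_] := wP z; case E : (w z).2 => [p|].
    move=> [_ _ /(_ (lK z zl) q rq zq) Nq]; exists p => //.
    by rewrite mem_pmap; apply/mapP; exists z.
  by move=> /(_ q rq zq).
have lindZ : lindelof Z.
  apply: usco_lindelof uscoZ _; apply/seteqP; split=> // p _.
  have [s _ Ks] : (\bigcup_s K s) (val p).2 by rewrite KT.
  by exists (join (fun i => if i == 0 then s else (val p).1)) => //=; rewrite !selK.
pose A := closure (range eps).
pose Kc := initial_topology (val : A -> cantor_space * K0).
have Ae (p : Z) : eps p \in A by apply/mem_set/subset_closure; exists p.
pose ec (p : Z) : Kc := SigSub (Ae p).
have cechZ : cech_complete Z.
  split; first exact: tychonoff_initial epsinj (tychonoff_compact hCK cCK).
  exists Kc, ec; split.
  - exact: compact_initial_closed cCK (@closed_closure _ _).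
  - apply: hausdorff_injective hCK (@initial_continuous _ _ _) _.
    exact: val_inj.
  - split.
    + apply/continuousP => _ [W oW <-]; exists W => //.
    + by move=> p q /(congr1 val)/epsinj.
    + move=> _ [W oW <-]; exists (val @^-1` W); split; first by exists W.
      apply/seteqP; split=> [_ [p Wp <-]|k [Wp [p _ epp]]]; first by split => //; exists p.
      by exists p => //; move: Wp; rewrite -epp.
  - move=> U [k Uk] [W oW WU].
    have Wk : W (val k) by rewrite -[W _]/((val @^-1` W) k) WU.
    have [|_ [[p _ <-] Wp]] := set_mem (valP k) W; first exact: open_nbhs_nbhs.
    by exists (ec p); split; [rewrite -WU|exists p].
  (* Inside the closure these open conditions cut out the image: every row of the first coordinate
     contains a bit, and the second coordinate lies in every [V n]. *)
  - pose VC n : set Kc := val @^-1` [set a : cantor_space * K0 |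
      (exists m, a.1 (code n m) = true) /\ V n a.2].
    exists VC; split.
      move=> n; exists [set a : cantor_space * K0 |
        (exists m, a.1 (code n m) = true) /\ V n a.2] => //.
      have -> : [set a : cantor_space * K0 |
          (exists m, a.1 (code n m) = true) /\ V n a.2] =
        (\bigcup_m [set a : cantor_space | a (code n m) = true]) `*` V n.
        apply/seteqP; split=> [[a t] [/= [m am] Vt]|[a t] [/= [m _ am] Vt]].
          by split => //; exists m.
        by split => //; exists m.
      apply: open_setX => //; apply: bigcup_open => m _.
      by rewrite openE => a am; exact: nbhs_bit.
    apply/seteqP; split=> [_ [p _ <-] n _|].
      split => /=; first by exists ((val p).1 n); apply/graphP.
      have : range e (e (val p).2) by exists (val p).2.
      by rewrite eV; exact.
    move=> k kV.
    have /choice[r rP] : forall n, exists m, (val k).1 (code n m) = true.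
      by move=> n; have [] := kV n I.
    have [z _ ez] : range e (val k).2.
      by rewrite eV => n _; have [] := kV n I.
    have clk W1 : nbhs (val k).1 W1 -> forall W2, nbhs (val k).2 W2 ->
        exists p : Z, W1 (graph (val p).1) /\ W2 (e (val p).2).
      move=> W1k W2 W2k.
      have [|_ [[p _ <-] [W1p W2p]]] := set_mem (valP k) (W1 `*` W2).
        by exists (W1, W2).
      by exists p.
    (* A row cannot contain two bits: both would persist at a nearby graph, where a row has only
       one. *)
    have gr : graph r = (val k).1.
      apply/funext => p; apply/idP/idP => [/asboolP[i ->]|kp]; first exact: rP.
      have [q [/asboolP[i pE] _]] := clk _ (nbhs_bit kp) setT filterT.
      have [q' [[]]] := clk _ (filterI (nbhs_bit kp) (nbhs_bit (rP i))) setT filterT.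
      rewrite pE => /graphP qi /graphP ri _.
      by apply/asboolP; exists i; rewrite -ri qi.
    (* A failure would persist near [(r, z)], but pairs from [B] come arbitrarily close. *)
    have Dr : D r (f z).
      apply: contrapT => /cD[n [U Uz UD]].
      have := cf Uz; rewrite /= nbhs_filterE nbhsE => -[G [oG Gz] GU].
      have [W [oW WG]] := eo G oG.
      have [||q [qr Wq]] := clk [set a | forall i, (i < n)%N -> a (code i (r i)) = true] _ W.
      - by rewrite -gr; exact: nbhs_graph.
      - apply: open_nbhs_nbhs; split => //; rewrite -ez.
        have : (e @` G) (e z) by exists z.
        by rewrite WG => -[].
      have : (e @` G) (e (val q).2) by rewrite WG; split => //; exists (val q).2.
      move=> [z' Gz' /einj zz']; apply: (UD (val q).1 (f (val q).2)).
      - by move=> i /qr/graphP.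
      - by rewrite -zz'; exact: GU.
      - exact: set_mem (valP q).
    have Bp : (r, z) \in B by exact: mem_set.
    exists (SigSub Bp : Z) => //; apply: val_inj => /=.
    by rewrite /eps /= gr ez -surjective_pairing.
exists Z, (fun p => f (val p).2); split => //.
  move=> p U /cf; rewrite /= nbhs_filterE nbhsE => -[G [oG Gp] GU].
  have [W [oW WG]] := eo G oG.
  exists (eps @^-1` (setT `*` W)); split.
  - exists (setT `*` W) => //; exact: open_setX openT oW.
  - split => //; have : (e @` G) (e (val p).2) by exists (val p).2.
    by rewrite WG => -[].
  - move=> q [_ /= Wq]; apply: GU.
    have : (e @` G) (e (val q).2) by rewrite WG; split => //; exists (val q).2.
    by move=> [z Gz /einj <-].
apply/seteqP; split=> [_ [p _ <-]|_ [[z _ <-] [s Ds]]].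
  by split; [exists (val p).2|exists (val p).1; exact: set_mem (valP p)].
have Bp : (s, z) \in B by exact: mem_set.
by exists (SigSub Bp).
Qed.

End souslin_K_analytic.

Lemma souslin_K_analytic (X : topologicalType) (E : set X) :
  K_analytic X -> souslin E -> K_analytic_set E.
Proof.
move=> [_ [Z [f [lZ cZ cf fT]]]] [D cD ->].
have := souslin_K_analytic_image lZ cZ cf cD.
by rewrite fT; congr K_analytic_set; apply/seteqP; split=> x // -[].
Qed.

(** * Borel hulls modulo a sigma-ideal and the Baire property *)

Section generated.
Variables (T : Type) (G : set (set T)).

Lemma gen_set0 : <<s G >> set0.
Proof. by have [] := smallest_sigma_algebra setT G. Qed.

Lemma gen_setC A : <<s G >> A -> <<s G >> (~` A).
Proof.
by move=> gA; have [_ + _] := smallest_sigma_algebra setT G => /(_ A gA); rewrite setTD.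
Qed.

Lemma gen_bigcup (F : nat -> set T) :
  (forall n, <<s G >> (F n)) -> <<s G >> (\bigcup_n F n).
Proof. by have [_ _] := smallest_sigma_algebra setT G; apply. Qed.

Lemma gen_setU A B : <<s G >> A -> <<s G >> B -> <<s G >> (A `|` B).
Proof.
move=> gA gB; have -> : A `|` B = \bigcup_n (if n == 0 then A else B).
  apply/seteqP; split=> [x [Ax|Bx]|x [n _]]; [by exists 0|by exists 1|].
  by case: eqP; [left|right].
by apply: gen_bigcup => n; case: eqP.
Qed.

Lemma gen_setI A B : <<s G >> A -> <<s G >> B -> <<s G >> (A `&` B).
Proof.
move=> gA gB; rewrite -[A]setCK -[B]setCK -setCU.
by apply: gen_setC; apply: gen_setU; exact: gen_setC.
Qed.

Lemma gen_setD A B : <<s G >> A -> <<s G >> B -> <<s G >> (A `\` B).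
Proof. by move=> gA gB; rewrite setDE; apply: gen_setI => //; exact: gen_setC. Qed.

Lemma gen_countable_union (F : set (set T)) : countable F ->
  F `<=` <<s G >> -> <<s G >> (\bigcup_(A in F) A).
Proof.
move=> /countable_injP[f finj] FG.
have -> : \bigcup_(A in F) A =
    \bigcup_n (\bigcup_(A in [set A | F A /\ f A = n]) A).
  apply/seteqP; split=> [x [A FA Ax]|x [n _ [A [FA _] Ax]]]; last by exists A.
  by exists (f A) => //; exists A.
apply: gen_bigcup => n.
have [[A [FA fA]]|nA] := pselect (exists A, F A /\ f A = n); last first.
  rewrite (_ : \bigcup_(_ in _) _ = set0); first exact: gen_set0.
  by rewrite -subset0 => x [A [FA fA]]; case: nA; exists A.
rewrite (_ : \bigcup_(_ in _) _ = A); first exact: FG.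
apply/seteqP; split=> [x [B [FB fB] Bx]|x Ax]; last by exists A.
by have -> : A = B by apply: finj; rewrite ?inE// fA.
Qed.

End generated.

Lemma borel_open (X : topologicalType) (U : set X) : open U -> borel_sets U.
Proof. by move=> oU; apply: sub_sigma_algebra. Qed.

Lemma borel_closed (X : topologicalType) (C : set X) : closed C -> borel_sets C.
Proof.
move=> cC; rewrite -[C]setCK; apply: gen_setC; apply: borel_open.
exact: closed_openC.
Qed.

Lemma borel_preimage (X Y : topologicalType) (f : X -> Y) (B : set Y) :
  continuous f -> borel_sets B -> borel_sets (f @^-1` B).
Proof.
move=> cf /(_ [set B | borel_sets (f @^-1` B)]); apply; split.
  split=> /=; first by rewrite preimage_set0; exact: gen_set0.
    by move=> A bA; rewrite setTD preimage_setC; exact: gen_setC.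
  by move=> F bF; rewrite preimage_bigcup; exact: gen_bigcup.
by move=> U oU; apply: borel_open; apply: open_comp.
Qed.

Definition is_hull (X : topologicalType) (J : set (set X)) (E H : set X) :=
  [/\ borel_sets H, E `<=` H & forall C, borel_sets C -> E `<=` C -> J (H `\` C)].

(* Replacing every piece of a Souslin scheme by a hull inside its closure changes
   the result by countably many sets of [J]. *)
Lemma marczewski (X : topologicalType) (J : set (set X)) (E : set X) : sideal J ->
  (forall E, exists H, is_hull J E H) -> souslin E ->
  exists H, [/\ borel_sets H, E `<=` H & J (H `\` E)].
Proof.
move=> HJ hJ [D cD ->]; have [J0 Jsub JU] := HJ.
pose Et (t : seq nat) := [set x | exists s, mkseq s (size t) = t /\ D s x].
have /choice[H HP] : forall t, exists H, is_hull J (Et t) H.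
  by move=> t; exact: hJ.
pose H' t := H t `&` closure (Et t).
have bH' t : borel_sets (H' t).
  apply: gen_setI; first by case: (HP t).
  by apply: borel_closed; exact: closed_closure.
have EH' t : Et t `<=` H' t.
  by move=> x Ex; split; [case: (HP t) => _ h _; exact: h|exact: subset_closure].
pose N := \bigcup_t (H' t `\` \bigcup_i H' (rcons t i)).
have JN : J N.
  apply: sideal_countType => // t; have [_ _ hmin] := HP t.
  apply: Jsub (hmin (\bigcup_i H' (rcons t i)) _ _) _.
  - by apply: gen_bigcup => i; exact: bH'.
  - move=> x [s [ts Ds]]; exists (s (size t)) => //; apply: EH'; exists s.
    by rewrite size_rcons mkseqS ts.
  - by move=> x [[Hx _] nx].
exists (H' [::]); split => //.
  by move=> x [s Ds]; apply: EH'; exists s.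
apply: Jsub JN _ => x [H0 nD]; apply: contrapT => nN.
(* Outside [N] a point in the hull of a node lies in the hull of some child, so it follows a whole
   branch [s]. As the hulls lie in the closures of the pieces, closedness of [D] then forces
   [D s x]. *)
have /choice[g gP] : forall t, exists i, H' t x -> H' (rcons t i) x.
  move=> t; have [Hx|nHx] := pselect (H' t x); last by exists 0.
  apply: contrapT => /forallNP h; apply: nN; exists t => //; split => //.
  by move=> [i _ Hi]; apply: (h i).
pose u := fix u n := if n is m.+1 then rcons (u m) (g (u m)) else [::].
pose s n := g (u n).
have us n : mkseq s n = u n by elim: n => // n IH; rewrite mkseqS IH.
have Hu n : H' (u n) x by elim: n => // n IH; exact: gP.
apply: nD; exists s; apply: contrapT => /cD[n [U Ux UD]].
have [_ cl] := Hu n; have [y [[s' [s'u Ds']] Uy]] := cl U Ux.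
apply: UD Uy Ds'; apply/agree_mkseq.
by rewrite us -s'u -us size_mkseq.
Qed.

(** Remove from the space a maximal disjoint family of Borel sets not in [I] that miss [E]. It is
    countable by the ccc, and a failure of minimality would produce another such set. *)
Lemma ccc_hull (X : topologicalType) (I : set (set X)) (E : set X) :
  sideal I -> ccc_ideal I -> exists H, is_hull I E H.
Proof.
move=> HI ccc.
have [F [FP Fdis Fmax]] :=
  maximal_disjoint [set B : set X | [/\ borel_sets B, ~ I B & B `&` E = set0]].
have cF : countable F by apply: ccc => // A /FP[].
exists (~` \bigcup_(A in F) A); split.
- by apply: gen_setC; apply: gen_countable_union => // A /FP[].
- move=> x Ex [A FA Ax]; have [_ _ AE] := FP A FA.
  by have : (A `&` E) x by []; rewrite AE.
- move=> C bC EC; apply: contrapT => nI.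
  have [|A FA [x [Ax [nx _]]]] := Fmax _ _ (sideal_nonempty HI nI).
    split=> //.
      apply: gen_setD => //.
      by apply: gen_setC; apply: gen_countable_union => // A /FP[].
    by rewrite -subset0 => x [[_ nC] /EC].
  by apply: nx; exists A.
Qed.

(** * Meager sets, the Banach category theorem and the Baire property *)

Section category.
Variable X : topologicalType.

Definition meager (E : set X) := exists2 U : nat -> set X,
  forall n, open (U n) /\ dense (U n) & E `<=` ~` \bigcap_n U n.

Lemma denseT : dense [set: X].
Proof. by move=> O O0 _; rewrite setIT. Qed.

Lemma meager_sideal : sideal meager.
Proof.
split.
- by exists (fun=> setT) => // n; split; [exact: openT|exact: denseT].
- by move=> A B [U oU BU] AB; exists U => //; exact: subset_trans AB BU.
- move=> F mF.
  have /choice[U UP] : forall n, exists U : nat -> set X,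
      (forall k, open (U k) /\ dense (U k)) /\ F n `<=` ~` \bigcap_k U k.
    by move=> n; have [U] := mF n; exists U.
  exists (fun m => if decode m is Some p then U p.1 p.2 else setT).
    move=> m; case: decode => [p|]; last by split; [exact: openT|exact: denseT].
    by have [oU _] := UP p.1; exact: oU.
  move=> x [n _ Fx] Ux; have [_ FU] := UP n.
  by apply: (FU x Fx) => k _; have := Ux (code n k) I; rewrite codeK.
Qed.

Lemma meager_dense_open (E G : set X) : open G -> dense G -> E `&` G = set0 ->
  meager E.
Proof.
move=> oG dG EG; exists (fun=> G) => // x Ex h.
have : (E `&` G) x by split => //; exact: (h 0 I).
by rewrite EG.
Qed.

Lemma dense_closureC (G : set X) : dense (G `|` ~` closure G).
Proof.
move=> V [x Vx] oV; have [cx|ncx] := pselect (closure G x).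
  have [y [Gy Vy]] := cx V (open_nbhs_nbhs (conj oV Vx)).
  by exists y; split => //; left.
by exists x; split => //; right.
Qed.

Lemma meager_boundary (G : set X) : open G -> meager (closure G `\` G).
Proof.
move=> oG; apply: meager_dense_open (@dense_closureC G) _.
  by apply: openU => //; exact: closed_openC (@closed_closure _ _).
by rewrite -subset0 => x [[cx nG] [//|]].
Qed.

Lemma baire_nonmeager (O : set X) : baire X -> open O -> O !=set0 -> ~ meager O.
Proof.
move=> bX oO O0 [U oU OU]; have [x [Ox Ux]] := bX U oU O O0 oO.
exact: OU Ox Ux.
Qed.

Definition baire_property (E : set X) :=
  exists2 G : set X, open G & meager (E `\` G) /\ meager (G `\` E).

Lemma borel_baire_property : @borel_sets X `<=` baire_property.
Proof.
have [M0 Msub MU] := meager_sideal.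
have MU2 := sidealU meager_sideal.
apply: smallest_sub; last first.
  by move=> U oU; exists U => //; rewrite setDv.
split.
- by exists set0; [exact: open0|rewrite setDv].
- move=> E [G oG [EG GE]]; rewrite setTD; exists (~` closure G).
    exact: closed_openC (@closed_closure _ _).
  split.
    apply: Msub (MU2 _ _ GE (meager_boundary oG)) _ => x [nE /contrapT cG].
    by have [Gx|nG] := pselect (G x); [left|right].
  apply: Msub EG _ => x [ncG /contrapT Ex]; split => // Gx; apply: ncG.
  exact: subset_closure.
- move=> E bE.
  have /choice[G GP] : forall n, exists G : set X,
      open G /\ meager (E n `\` G) /\ meager (G `\` E n).
    by move=> n; have [G] := bE n; exists G.
  exists (\bigcup_n G n).
    by apply: bigcup_open => n _; case: (GP n).
  split.
    apply: Msub (MU (fun n => E n `\` G n) _) _.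
      by move=> n; case: (GP n) => _ [].
    move=> x [[n _ Ex] nG]; exists n => //; split => // Gx; apply: nG.
    by exists n.
  apply: Msub (MU (fun n => G n `\` E n) _) _.
    by move=> n; case: (GP n) => _ [].
  move=> x [[n _ Ex] nG]; exists n => //; split => // Gx; apply: nG.
  by exists n.
Qed.

(** Over a maximal disjoint family of open sets in which [E] is meager, the witnessing dense open
    sets can be glued. By maximality the remaining part lies in the boundary of the union of the
    family. *)
Lemma banach_category (E : set X) :
  meager (E `&` \bigcup_(V in [set V | open V /\ meager (E `&` V)]) V).
Proof.
have [M0 Msub MU] := meager_sideal.
set Q := [set V | open V /\ _].
have [F [FP Fdis Fmax]] := maximal_disjoint Q.
pose G := \bigcup_(V in F) V.
have oG : open G by apply: bigcup_open => V /FP[].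
have /choice[W WP] : forall V, exists W : nat -> set X, F V ->
    (forall n, open (W n) /\ dense (W n)) /\ E `&` V `<=` ~` \bigcap_n W n.
  move=> V; have [/FP[_ [W oW EW]]|nFV] := pselect (F V); last by exists (fun=> set0).
  by exists W.
have mEG : meager (E `&` G).
  exists (fun n => (\bigcup_(V in F) (V `&` W V n)) `|` ~` closure G).
    move=> n; split.
      apply: openU; last exact: closed_openC (@closed_closure _ _).
      apply: bigcup_open => V FV; apply: openI; first by case: (FP V FV).
      by have [oW _] := WP V FV; case: (oW n).
    move=> O O0 oO.
    have [x [Ox [[V FV Vx]|ncG]]] := @dense_closureC G O O0 oO; last first.
      by exists x; split => //; right.
    have [oW _] := WP V FV; have [_ dW] := oW n.
    have [||y [[Oy Vy] Wy]] := dW (O `&` V); first by exists x.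
      by apply: openI => //; case: (FP V FV).
    by exists y; split => //; left; exists V.
  move=> x [Ex [V FV Vx]] h; have [_ EW] := WP V FV.
  apply: (EW x) => // n _; have [[V' FV' [V'x W'x]]|ncG] := h n I.
    have [<-//|VV'] := pselect (V' = V).
    have := Fdis V V' FV FV' (nesym VV') => VV0.
    by have : (V `&` V') x by []; rewrite VV0.
  by exfalso; apply: ncG; apply: subset_closure; exists V.
apply: (Msub _ _ (sidealU meager_sideal mEG (meager_boundary oG))).
move=> x [Ex [V [oV mV] Vx]].
have [Gx|nGx] := pselect (G x); first by left.
right; split => //; apply: contrapT => ncG.
have [||A FA [y [Ay [Vy ncy]]]] := Fmax (V `&` ~` closure G).
- split; first by apply: openI => //; exact: closed_openC (@closed_closure _ _).
  by apply: Msub mV _ => y [Ey []].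
- by exists x.
- by apply: ncy; apply: subset_closure; exists A.
Qed.

(** [E] is meager in [U], so the hull is the complement of [U] up to a meager set. If a Borel [C]
    contains [E], the complement of [C] is an open [G] modulo meager sets; [E] is meager in [G],
    hence [G] lies in [U]. *)
Lemma meager_hull (E : set X) : exists H, is_hull meager E H.
Proof.
have [M0 Msub MU] := meager_sideal.
set U := \bigcup_(V in [set V | open V /\ meager (E `&` V)]) V.
have [W oW EW] : meager (E `&` U) := banach_category E.
have mW : meager (~` \bigcap_n W n) by exists W.
have oU : open U by apply: bigcup_open => V [].
exists (~` U `|` ~` \bigcap_n W n); split.
- apply: gen_setU; first by apply: gen_setC; exact: borel_open.
  rewrite setC_bigcap; apply: gen_bigcup => n; apply: gen_setC.
  by apply: borel_open; case: (oW n).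
- by move=> x Ex; have [Ux|] := pselect (U x); [right; exact: EW|left].
- move=> C bC EC.
  have [G oG [CG GC]] := borel_baire_property (gen_setC bC).
  have GU : G `<=` U.
    move=> x Gx; exists G => //; split => //.
    apply: Msub GC _ => y [Ey Gy]; split => //; apply; exact: EC.
  apply: Msub (sidealU meager_sideal mW CG) _ => x [[nU|nW] nC].
    by right; split => // /GU.
  by left.
Qed.

Lemma souslin_nonmeager (E : set X) : souslin E -> ~ meager E ->
  exists G, [/\ open G, G !=set0 & meager (G `\` E)].
Proof.
move=> sE nE; have [H [bH EH mH]] := marczewski meager_sideal meager_hull sE.
have [M0 Msub MU] := meager_sideal.
have [G oG [HG GH]] := borel_baire_property bH.
exists G; split => //.
  apply/set0P/eqP => G0; apply: nE; apply: Msub HG _ => x /EH Hx.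
  by rewrite G0; split.
apply: Msub (sidealU meager_sideal GH mH) _ => x [Gx nEx].
by have [Hx|nHx] := pselect (H x); [right|left].
Qed.

End category.

(** * Topological groups *)

Lemma souslin_usco (X : topologicalType) (K : (nat -> nat) -> set X) (E : set X) :
  usco K -> \bigcup_s K s = setT -> souslin E ->
  exists2 L : (nat -> nat) -> set X, usco L & \bigcup_s L s = E.
Proof.
move=> uK KT [D cD ->]; exists (fun s => K (sel 0 s) `&` D (sel 1 s)).
  exact: usco_bclosedI.
apply/seteqP; split=> [x [s _ [_ Ds]]|x [s Ds]]; first by exists (sel 1 s).
have [r _ Kr] : (\bigcup_s K s) x by rewrite KT.
by exists (join (fun i => if i == 0 then r else s)); rewrite ?selK.
Qed.

Lemma fborel_borel (X : topologicalType) : @fborel_sets X `<=` @borel_sets X.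
Proof. by move=> _ [f [B [cf bB ->]]]; exact: borel_preimage. Qed.

(** The ccc speaks of Borel sets only. The error between a Souslin set and its hull is enclosed in a
    Borel member of [I], which is then subtracted from the hull. *)
Lemma souslin_borel_inside (X : topologicalType) (I : set (set X)) (A : set X) :
  sideal I -> ccc_ideal I -> has_fborel_base I -> souslin A -> ~ I A ->
  exists B, [/\ borel_sets B, B `<=` A & ~ I B].
Proof.
move=> HI ccc base sA nA; have [_ Isub _] := HI.
have [H [bH AH HA]] := marczewski HI (fun E => ccc_hull E HI ccc) sA.
have [N [/fborel_borel bN IN HN]] := base _ HA.
exists (H `\` N); split.
- exact: gen_setD.
- by move=> x [Hx nN]; apply: contrapT => nAx; apply: nN; exact: HN.
- by apply: sidealD => // IH; apply: nA; exact: Isub IH AH.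
Qed.

Lemma meager_homeo (X : topologicalType) (f g : X -> X) (E : set X) :
  continuous f -> continuous g -> cancel f g -> cancel g f ->
  meager E -> meager (f @` E).
Proof.
move=> cf cg fK gK [U oU EU]; exists (fun n => g @^-1` U n).
  move=> n; have [oUn dU] := oU n; split; first exact: open_comp.
  move=> O [x Ox] oO; have [||y [Ofy Uy]] := dU (f @^-1` O).
  - by exists (g x); rewrite /preimage /= gK.
  - exact: open_comp.
  - by exists (f y); split; rewrite // /preimage /= fK.
by move=> _ [x Ex <-] h; apply: (EU x Ex) => n _; have := h n I; rewrite /preimage /= fK.
Qed.

Section topological_group.
Variables (X : topologicalType) (mul : X -> X -> X) (inv : X -> X) (one : X).
Hypothesis HX : is_topgroup mul inv one.
Local Notation "x * y" := (mul x y).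
Local Notation "x ^-1" := (inv x).

Lemma tgA x y z : x * (y * z) = x * y * z. Proof. by case: HX. Qed.
Lemma tg1 x : one * x = x. Proof. by have [_ /(_ x)[]] := HX. Qed.
Lemma tgr1 x : x * one = x. Proof. by have [_ /(_ x)[]] := HX. Qed.
Lemma tgV x : x^-1 * x = one. Proof. by have [_ _ /(_ x)[]] := HX. Qed.
Lemma tgrV x : x * x^-1 = one. Proof. by have [_ _ /(_ x)[]] := HX. Qed.
Lemma tgK x y : x^-1 * (x * y) = y. Proof. by rewrite tgA tgV tg1. Qed.
Lemma tgVK x y : x * (x^-1 * y) = y. Proof. by rewrite tgA tgrV tg1. Qed.
Lemma tgrK x y : y * x * x^-1 = y. Proof. by rewrite -tgA tgrV tgr1. Qed.
Lemma tgrVK x y : y * x^-1 * x = y. Proof. by rewrite -tgA tgV tgr1. Qed.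
Lemma tgI x y z : x * y = x * z -> y = z.
Proof. by move=> /(congr1 (mul x^-1)); rewrite !tgK. Qed.
Lemma tgVV x : x^-1^-1 = x.
Proof. by apply: (@tgI x^-1); rewrite tgrV tgV. Qed.
Lemma tg1V : one^-1 = one. Proof. by rewrite -[LHS]tg1 tgrV. Qed.
Lemma tgMV x y : (x * y)^-1 = y^-1 * x^-1.
Proof. by apply: (@tgI (x * y)); rewrite tgrV tgA tgrK tgrV. Qed.

Lemma tg_mul_nbhs a b (U : set X) : nbhs (a * b) U -> exists V W,
  [/\ nbhs a V, nbhs b W & forall x y, V x -> W y -> U (x * y)].
Proof.
have [_ _ _ cm _] := HX.
move=> /(cm (a, b))[[/= V W] [Va Wb] VWU]; exists V, W; split => // x y Vx Wy.
exact: (VWU (x, y)).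
Qed.

Lemma tg_continuous_mulr a : continuous (fun x => a * x).
Proof.
move=> x U /tg_mul_nbhs[V [W [Va Wx VWU]]]; apply: filterS Wx => y Wy.
by apply: VWU => //; exact: nbhs_singleton.
Qed.

Lemma tg_continuous_mull a : continuous (fun x => x * a).
Proof.
move=> x U /tg_mul_nbhs[V [W [Vx Wa VWU]]]; apply: filterS Vx => y Vy.
by apply: VWU => //; exact: nbhs_singleton.
Qed.

Lemma tg_continuous_inv : continuous inv. Proof. by case: HX. Qed.

Lemma tg_continuous_div : continuous (fun p : X * X => p.1 * p.2^-1).
Proof.
move=> [a b] U /tg_mul_nbhs[V [W [Va Wb VWU]]].
exists (V, inv @^-1` W); first by split => //; exact: tg_continuous_inv.
by move=> [x y] [/= Vx Wy]; exact: VWU.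
Qed.

Lemma tg_nbhs1 a (U : set X) : nbhs a U -> nbhs one [set x | U (a * x)].
Proof. by move=> Ua; apply: tg_continuous_mulr; rewrite tgr1. Qed.

Lemma tg_nbhs_mul a (U : set X) : nbhs one U -> nbhs a [set x | U (a^-1 * x)].
Proof. by move=> U1; apply: tg_continuous_mulr; rewrite tgV. Qed.

Lemma tg_nbhs_mulr a (U : set X) : nbhs one U -> nbhs a [set x | U (x * a^-1)].
Proof. by move=> U1; apply: tg_continuous_mull; rewrite tgrV. Qed.

Section steinhaus.
Variables (K : (nat -> nat) -> set X) (I : set (set X)).
Hypotheses (uK : usco K) (KT : \bigcup_s K s = setT).
Hypotheses (hX : hausdorff_space X) (bX : baire X).
Hypotheses (HI : sideal I) (ccc : ccc_ideal I) (base : has_fborel_base I).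
Hypothesis Ileft : left_invariant mul I.

Lemma translateE a A : mul a @` A = (fun x => a^-1 * x) @^-1` A.
Proof.
apply/seteqP; split=> [_ [x Ax <-]|x Ax]; first by rewrite /preimage /= tgK.
by exists (a^-1 * x) => //; rewrite tgVK.
Qed.

Lemma left_invariantV a A : I (mul a @` A) -> I A.
Proof.
move=> /(Ileft a^-1); congr I; apply/seteqP; split=> [_ [_ [x Ax <-] <-]|x Ax].
  by rewrite tgK.
by exists (a * x); [exists x|rewrite tgK].
Qed.

Lemma souslin_division A : souslin A -> souslin [set a * b^-1 | a in A & b in A].
Proof.
move=> /(souslin_usco uK KT)[L uL LA].
have := usco_souslin hX (usco_image2 tg_continuous_div uL uL).
congr souslin; apply/seteqP; split=> [_ [s _ [a La [b Lb <-]]]|_ [a Aa [b Ab <-]]].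
  by exists a; rewrite -LA; [exists (sel 0 s)|exists b => //; exists (sel 1 s)].
move: Aa Ab; rewrite -LA => -[s _ Ls] [r _ Lr].
exists (join (fun i => if i == 0 then s else r)) => //; rewrite !selK.
by exists a => //; exists b.
Qed.

(* By the ccc, a maximal disjoint family of translates of a positive Borel
   subset of [A] is countable, so countably many translates of [A A^-1] cover. *)
Lemma division_nonmeager A : souslin A -> ~ I A ->
  ~ meager [set a * b^-1 | a in A & b in A].
Proof.
move=> sA nA mP.
have [B [bB BA nB]] := souslin_borel_inside HI ccc base sA nA.
have [F [FP Fdis Fmax]] := maximal_disjoint (range (fun a => mul a @` B)).
have cF : countable F.
  apply: ccc => // C /FP[a _ <-]; split; last by move=> /left_invariantV.
  by rewrite translateE; apply: borel_preimage => //; exact: tg_continuous_mulr.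
have /choice[g gP] : forall C, exists a, F C -> C = mul a @` B.
  move=> C; have [/FP[a _ <-]|nFC] := pselect (F C); last by exists one.
  by exists a.
have [_ Msub _] := meager_sideal X.
have mT : meager [set: X].
  apply: (Msub _ (\bigcup_(C in F) mul (g C) @` [set a * b^-1 | a in A & b in A])).
    apply: (sideal_countable (meager_sideal X)) => // C _.
    apply: (@meager_homeo _ _ (fun x => (g C)^-1 * x)) => //.
    - exact: tg_continuous_mulr.
    - exact: tg_continuous_mulr.
    - by move=> x; rewrite tgK.
    - by move=> x; rewrite tgVK.
  move=> x _.
  have [||C FC [y [Cy [b Bb xy]]]] := Fmax (mul x @` B); first by exists x.
    by have [b Bb] := sideal_nonempty HI nB; exists (x * b); exists b.
  move: (Cy); rewrite (gP C FC) => -[a Ba ay].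
  exists C => //; exists (a * b^-1).
    by exists a; [exact: BA|exists b => //; exact: BA].
  by rewrite tgA ay -xy tgrK.
by apply: baire_nonmeager bX openT _ mT; exists one.
Qed.

(** The set [P] is comeager in a nonempty open [G]. For [g] near the identity [G] meets [gG], so by
    the Baire property of the space [P] meets [gP], and [g = z (g^-1 z)^-1] with both factors taken
    from [P]. *)
Lemma steinhaus A : souslin A -> ~ I A ->
  nbhs one [set g | exists a b c d, [/\ A a, A b, A c & A d] /\
    g = a * b^-1 * (c * d^-1)].
Proof.
move=> sA nA; set P := [set a * b^-1 | a in A & b in A].
have [G [oG [z0 Gz0] mG]] :=
  souslin_nonmeager (souslin_division sA) (division_nonmeager sA nA).
have : nbhs one [set g | G (g^-1 * z0)].
  have : nbhs (one^-1 * z0) G.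
    by rewrite tg1V tg1; exact: open_nbhs_nbhs.
  move=> /(@tg_continuous_mull z0 (one^-1)) /tg_continuous_inv.
  exact.
apply: filterS => g Gg.
have mgG : meager (mul g @` (G `\` P)).
  apply: (@meager_homeo _ _ (fun x => g^-1 * x)) => //.
  - exact: tg_continuous_mulr.
  - exact: tg_continuous_mulr.
  - by move=> x; rewrite tgK.
  - by move=> x; rewrite tgVK.
have [_ Msub _] := meager_sideal X.
have oGg : open (G `&` (fun x => g^-1 * x) @^-1` G).
  by apply: openI => //; apply: open_comp => // x _; exact: tg_continuous_mulr.
have [z nz] : exists z, G z /\ G (g^-1 * z) /\ P z /\ P (g^-1 * z).
  apply: contrapT => nz; apply: baire_nonmeager bX oGg _ _; first by exists z0.
  apply: Msub (sidealU (meager_sideal X) mG mgG) _ => z [Gz /= Ggz].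
  have [Pz|nPz] := pselect (P z); last by left.
  right; exists (g^-1 * z); last by rewrite tgVK.
  by split => // Pgz; apply: nz; exists z.
move: nz => [_ [_ [[a Aa [b Ab <-]] [c Ac [d Ad cd]]]]].
exists a, b, d, c; split => //.
have -> : d * c^-1 = (c * d^-1)^-1 by rewrite tgMV tgVV.
by rewrite cd tgMV tgVV tgA tgrV tg1.
Qed.

End steinhaus.

(** * Coding the translates of a functionally Borel set by sequences *)

Section labels.
Variable K : (nat -> nat) -> set X.
Hypotheses (uK : usco K) (KT : \bigcup_s K s = setT).

Lemma cover_seq (N : X -> set X) : (forall x, nbhs x (N x)) ->
  exists c : nat -> X, forall x, exists n, N (c n) x.
Proof.
move=> NP; have [C cC CN] := usco_countable_cover uK KT NP.
have [f finj] := countable_injP _ cC.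
have /choice[c cP] : forall n, exists y, (exists2 x, C x & f x = n) ->
    C y /\ f y = n.
  move=> n; have [[x Cx fx]|nx] := pselect (exists2 x, C x & f x = n).
    by exists x.
  by exists one.
exists c => x; have [y Cy Ny] := CN x; exists (f y).
have [Cc fc] := cP (f y) (ex_intro2 _ _ y Cy erefl).
by have -> : c (f y) = y by apply: finj; rewrite ?inE.
Qed.

(** Countably many translates [c U] cover the group, and [q x] is the index of one containing [x].
    Two points of the same translate differ by an element of [U^-1 U], which lies in [G]. *)
Lemma nbhs_label (G : set X) : nbhs one G ->
  exists q : X -> nat, forall x x', q x = q x' -> G (x^-1 * x').
Proof.
move=> G1; have : nbhs (one^-1 * one) G by rewrite tgr1 tg1V.
move=> /tg_mul_nbhs[V [W [V1 W1 VWG]]].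
have U1 : nbhs one (inv @^-1` V `&` W).
  by apply: filterI => //; exact: tg_continuous_inv.
have [c cP] := cover_seq (fun x => tg_nbhs_mul x U1).
have [q qP] := choice cP.
exists q => x x' qx; have [Vx _] := qP x; have [_ Wx'] := qP x'.
have := VWG _ _ Vx Wx'.
by rewrite qx tgMV tgVV -tgA tgVK.
Qed.

Import Order.TTheory GRing.Theory Num.Theory.
Import numFieldNormedType.Exports.
Local Notation R := Rdefinitions.R.

Let near_add (F : realFieldType) (a b c e : F) :
  (`|b - c| < e -> `|b - a| < e -> `|a - c| < e + e)%R.
Proof. by rewrite !ltr_norml => /andP[? ?] /andP[? ?]; apply/andP; split; lra. Qed.

(** For [z = v c] both [f z] and [f (k z)] are within [e] of [f c] when [v] and [k] lie in a
    neighbourhood depending on [c] only. Countably many [c] suffice by the Lindelof property, so the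
    bound is uniform in [z]. *)
Lemma almost_invariant (f : X -> R) (e : R) : continuous f -> (0 < e)%R ->
  exists G : nat -> set X, (forall n, nbhs one (G n)) /\
    forall k, (forall n, G n k) -> forall z, (`|f (mul k z) - f z| < e + e)%R.
Proof.
move=> cf e0.
have /choice[G GP] : forall z, exists G, nbhs one G /\
    forall u v, G u -> G v -> (`|f z - f (mul u (mul v z))| < e)%R.
  move=> z; have : nbhs (one * (one * z)) (f @^-1` ball (f z) e).
    by rewrite !tg1; apply: cf; exact: nbhsx_ballx.
  move=> /tg_mul_nbhs[V [W [V1 W1 VW]]].
  exists (V `&` [set v | W (v * z)]); split.
    by apply: filterI => //; exact: tg_continuous_mull W1.
  by move=> u v [Vu _] [_ Wv]; exact: VW.
have [c cP] := cover_seq (fun z => tg_nbhs_mulr z (GP z).1).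
exists (G \o c); split; first by move=> n; case: (GP (c n)).
move=> k Gk z; have [n Gn] := cP z; have [G1 GG] := GP (c n).
have zE : z * (c n)^-1 * c n = z by rewrite tgrVK.
have a := GG _ _ (Gk n) Gn; have b := GG _ _ (nbhs_singleton G1) Gn.
rewrite zE in a; rewrite tg1 zE in b.
exact: near_add b a.
Qed.

(** Equal labels put [x^-1 * x'] into all the neighbourhoods attached to each coordinate of [g] and
    each precision [1/(j+1)]. Translation by it therefore changes no coordinate at all. *)
Lemma translate_label (g : X -> {ptws nat -> R}) : continuous g ->
  exists l : X -> nat -> nat, forall x x', l x = l x' ->
    forall z, g (x^-1 * z) = g (x'^-1 * z).
Proof.
move=> cg.
have cgi i : continuous (fun x => g x i).
  move=> x; apply: (@continuous_comp _ _ _ g (fun y : {ptws nat -> R} => y i)).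
    exact: cg.
  exact: (@proj_continuous nat (fun=> R) i).
have /choice[G GP] : forall p : nat * nat, exists G : nat -> set X,
    (forall n, nbhs one (G n)) /\ forall k, (forall n, G n k) -> forall z,
      (`|g (mul k z) p.1 - g z p.1| < p.2.+1%:R^-1 + p.2.+1%:R^-1)%R.
  by move=> p; apply: almost_invariant => //; rewrite invr_gt0.
have /choice[q qP] : forall p : nat * nat * nat, exists q : X -> nat,
    forall x x', q x = q x' -> G p.1 p.2 (x^-1 * x').
  by move=> p; apply: nbhs_label; case: (GP p.1).
exists (fun x => join (fun i => join (fun j m => q (i, j, m) x))) => x x' ll z.
apply/funext => i; have -> : x^-1 * z = x^-1 * x' * (x'^-1 * z) by rewrite -tgA tgVK.
apply/eqP; rewrite -subr_eq0 -normr_le0; apply/ler_addgt0Pr => e e0.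
rewrite add0r; have e2 : (0 < e / 2)%R by rewrite divr_gt0.
have [j _ /(_ j (leqnn j)) je] := near_infty_natSinv_lt (PosNum e2).
have kG m : G (i, j) m (x^-1 * x').
  apply: (qP (i, j, m)); have := congr1 (fun s => sel j (sel i s) m) ll.
  by rewrite !selK.
apply: le_trans (ltW ((GP (i, j)).2 _ kG (x'^-1 * z))) _.
by rewrite [leRHS]splitr lerD// ltW.
Qed.

End labels.

End topological_group.

(** * Semimeasurable sets, Cantor schemes, Stone refinements *)

Section semimeasurable.
Variables (X : topologicalType) (I : set (set X)).
Hypotheses (HI : sideal I) (ccc : ccc_ideal I) (base : has_fborel_base I).

Definition bisouslin (E : set X) := souslin E /\ souslin (~` E).

Lemma fborel_bisouslin (E : set X) : fborel_sets E -> bisouslin E.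
Proof.
move=> [f [B [cf bB ->]]]; split; apply: fborel_souslin; first by exists f, B.
by exists f, (~` B); split => //; exact: gen_setC.
Qed.

(** The error set [N] is kept co-Souslin so that it can later be subtracted from [F] without leaving
    the Souslin sets. *)
Lemma gen_with_bisouslin (E : set X) : gen_with (@fborel_sets X) I E ->
  exists F N, [/\ bisouslin F, souslin (~` N), I N & (E `\` F) `|` (F `\` E) `<=` N].
Proof.
have [I0 Isub IU] := HI.
have s0 : souslin (set0 : set X) by apply: souslin_closed; exact: closed0.
have sT : souslin [set: X] by apply: souslin_closed; exact: closedT.
pose P := [set E | exists F N, [/\ bisouslin F, souslin (~` N), I N &
  (E `\` F) `|` (F `\` E) `<=` N]].
suff : gen_with (@fborel_sets X) I `<=` P by move=> h; exact: h.
apply: smallest_sub; last first.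
  move=> A [fA|IA].
    exists A, set0; split=> //; first exact: fborel_bisouslin.
      by rewrite setC0.
    by rewrite setDv setU0.
  have [N [fN IN AN]] := base IA.
  exists set0, N; split=> //.
  - by split=> //; rewrite setC0.
  - by case: (fborel_bisouslin fN).
  - by rewrite setD0 set0D setU0.
split.
- by exists set0, set0; rewrite /bisouslin !setC0 setDv setU0; split.
- move=> A [F [N [[sF sFC] sN IN FN]]]; rewrite setTD.
  exists (~` F), N; split => //; first by split => //; rewrite setCK.
  move=> x [[nA /contrapT Fx]|[nF /contrapT Ax]]; apply: FN; [right|left];
    by split.
- move=> A AP.
  have /choice[F FP] : forall n, exists F, exists N,
      [/\ bisouslin F, souslin (~` N), I N & (A n `\` F) `|` (F `\` A n) `<=` N].
    exact: AP.
  have {FP}/choice[N FP] := FP.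
  exists (\bigcup_n F n), (\bigcup_n N n); split.
  + split; first by apply: souslin_bigcup => n; case: (FP n) => -[].
    rewrite setC_bigcup; apply: souslin_bigcap => n.
    by case: (FP n) => -[].
  + rewrite setC_bigcup; apply: souslin_bigcap => n.
    by case: (FP n).
  + by apply: IU => n; case: (FP n).
  + move=> x [[[n _ Ax] nF]|[[n _ Fx] nA]]; exists n => //;
      have [_ _ _ FN] := FP n; apply: FN; [left|right]; split => // h;
      by [apply: nF; exists n|apply: nA; exists n].
Qed.

Lemma gen_with_inner_souslin (E : set X) : gen_with (@fborel_sets X) I E ->
  exists B, [/\ souslin B, B `<=` E & I (E `\` B)].
Proof.
have [I0 Isub IU] := HI.
move=> /gen_with_bisouslin[F [N [[sF _] sN IN FN]]].
exists (F `\` N); split.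
- by rewrite setDE; exact: souslinI.
- by move=> x [Fx nN]; apply: contrapT => nE; apply: nN; apply: FN; right.
- apply: Isub IN _ => x [Ex nFN]; apply: contrapT => nN; apply: nFN; split => //.
  by apply: contrapT => nF; apply: nN; apply: FN; left.
Qed.

Hypothesis XK : K_analytic X.
Let hX : hausdorff_space X. Proof. by case: XK => -[]. Qed.

Lemma gen_with_semimeasurable (E : set X) :
  gen_with (@fborel_sets X) I E -> semimeasurable_set I E.
Proof.
have [I0 Isub IU] := HI.
move=> /gen_with_inner_souslin[B [sB BE IB]] A kA nAE.
exists (A `&` B); split.
- by apply: souslin_K_analytic => //; apply: souslinI => //; exact: K_analytic_souslin.
- by move=> x [Ax Bx]; split => //; exact: BE.
- move=> IAB; apply: nAE; apply: Isub (sidealU HI IAB IB) _ => x [Ax Ex].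
  by have [Bx|nBx] := pselect (B x); [left|right].
Qed.

Hypothesis HBo : @borel_sets X `<=` gen_with (@fborel_sets X) I.

(** Let [H] be a Borel hull of the complement of [M], and [A], [B] Souslin kernels of [H] and of its
    complement. Then [B] lies in [M], and [A] meets [M] in a null set: otherwise semimeasurability
    yields a positive Borel part of [M] inside [H], contradicting the minimality of the hull. *)
Lemma semimeasurable_inner_souslin (M : set X) : semimeasurable_set I M ->
  exists B, [/\ souslin B, B `<=` M & I (M `\` B)].
Proof.
have [I0 Isub IU] := HI.
move=> sM; have [H [bH MH Hmin]] := ccc_hull (~` M) HI ccc.
have [A [sA AH IHA]] := gen_with_inner_souslin (HBo bH).
have [B [sB BH IB]] := gen_with_inner_souslin (HBo (gen_setC bH)).
have IAM : I (A `&` M).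
  apply: contrapT => nAM.
  have [B' [kB' B'AM nB']] := sM A (souslin_K_analytic XK sA) nAM.
  have [C [bC CB' nC]] :=
    souslin_borel_inside HI ccc base (K_analytic_souslin hX kB') nB'.
  apply: nC; apply: Isub (Hmin (H `\` C) _ _) _; first exact: gen_setD.
    by move=> x nM; split; [exact: MH|move=> /CB'/B'AM[]].
  by move=> x Cx; split; [apply: AH; case: (B'AM _ (CB' _ Cx))|case].
exists B; split => //; first by move=> x /BH nH; apply: contrapT => /MH.
apply: (Isub _ _ (sidealU HI IB (sidealU HI IAM IHA))) => x [Mx nB].
have [Hx|nH] := pselect (H x); last by left.
by right; have [Ax|nA] := pselect (A x); [left|right].
Qed.

End semimeasurable.

(** * Cantor schemes with distinct labels along distinct branches *)

Section cantor_scheme.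

(* The first [n] digits of [e], the latest one first. *)
Fixpoint pre (e : nat -> bool) n : seq bool :=
  if n is m.+1 then e m :: pre e m else [::].

(** Digit [n] is read at depth [n+1], where a scheme of strictly growing strings has more than [n]
    entries. *)
Definition lim_scheme (u : seq bool -> seq nat) (e : nat -> bool) : nat -> nat :=
  fun n => nth 0 (u (pre e n.+1)) n.

(** The characteristic function of the graph of [u]. Schemes thus become points of the Cantor space,
    as the Bernstein construction requires of its index set. *)
Definition encode_scheme (u : seq bool -> seq nat) : nat -> bool :=
  fun n => `[< exists l, n = pickle (l, u l) >].

Definition decode_scheme (a : nat -> bool) : seq bool -> seq nat :=
  fun l => xget [::] [set t | a (pickle (l, t)) = true].

Lemma encode_schemeK u : decode_scheme (encode_scheme u) = u.
Proof.
apply/funext => l; rewrite /decode_scheme; apply: xget_unique.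
  by apply/asboolP; exists l.
by move=> t /= /asboolP[l' /(pcan_inj pickleK)[-> ->]].
Qed.

Variables (X : Type) (I : set (set X)).
Hypothesis HI : sideal I.
Variables (P : (nat -> nat) -> set X) (y : (nat -> nat) -> nat -> nat).
Hypothesis P0 : forall s, P s = set0 ->
  exists n, forall s', agree n s s' -> P s' = set0.
Hypothesis cy : forall n, exists m, forall s s', agree m s s' -> agree n (y s) (y s').
Hypothesis nP : ~ I (\bigcup_s P s).
Hypothesis Py : forall c, I (\bigcup_(s in [set s | y s = c]) P s).

Let node (t : seq nat) := \bigcup_(s in [set s | mkseq s (size t) = t]) P s.

(** Discard all null nodes, of which there are countably many, and pick a point of what is left with
    code [s]; discard also the null set of points with label [y s] and pick another. Prefixes long
    enough to decide a digit where the two labels differ are positive nodes. *)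
Let split_node (t : seq nat) : ~ I (node t) -> exists t01 : seq nat * seq nat,
  [/\ ~ I (node t01.1), ~ I (node t01.2), (size t < size t01.1)%N /\
      take (size t) t01.1 = t, (size t < size t01.2)%N /\ take (size t) t01.2 = t &
      forall s s', mkseq s (size t01.1) = t01.1 -> mkseq s' (size t01.2) = t01.2 ->
        y s <> y s'].
Proof.
have [I0 Isub IU] := HI.
move=> nIt; pose Rem := \bigcup_(t in [set t | I (node t)]) node t.
have IRem : I Rem by apply: sideal_countable.
have nIt' := sidealD HI nIt IRem.
have [x [[s st Px] nRx]] := sideal_nonempty HI nIt'.
have [x' [[[s' s't Px'] nRx'] ny]] := sideal_nonempty HI (sidealD HI nIt' (Py (y s))).
have yss' : y s <> y s' by move=> ys; apply: ny; exists s'.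
have [k yk] : exists k, y s k <> y s' k.
  by apply/existsNP => h; apply: yss'; apply/funext.
have [m mP] := cy k.+1.
pose m' := maxn m (size t).+1.
have pos z r : P r z -> ~ Rem z -> ~ I (node (mkseq r m')).
  move=> Prz nRz Ir; apply: nRz; exists (mkseq r m') => //; exists r => //=.
  by rewrite size_mkseq.
have tk r : mkseq r (size t) = t -> (size t < size (mkseq r m'))%N /\
    take (size t) (mkseq r m') = t.
  move=> rt; rewrite size_mkseq leq_max ltnSn orbT; split => //.
  by rewrite -[RHS]rt /mkseq -map_take take_iota (minn_idPl _)// leq_max leqnSn orbT.
exists (mkseq s m', mkseq s' m'); split=> /=.
- exact: pos Px nRx.
- exact: pos Px' nRx'.
- exact: tk.
- exact: tk.
- move=> r r'; rewrite !size_mkseq => /agree_mkseq rs /agree_mkseq r's' yr.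
  apply: yk; have le := leq_maxl m (size t).+1.
  rewrite -(mP r s (agree_le le rs) k (ltnSn k)).
  by rewrite -(mP r' s' (agree_le le r's') k (ltnSn k)) yr.
Qed.

(** Iterated splitting keeps every node positive. A limit with empty [P] would make a whole node
    empty by [P0], and two branches get distinct labels where they part. *)
Lemma cantor_scheme : exists u : seq bool -> seq nat,
  injective (fun e => y (lim_scheme u e)) /\ forall e, P (lim_scheme u e) !=set0.
Proof.
have [I0 Isub IU] := HI.
have /choice[g gP] : forall t, exists t01 : seq nat * seq nat, ~ I (node t) ->
  [/\ ~ I (node t01.1), ~ I (node t01.2), (size t < size t01.1)%N /\
      take (size t) t01.1 = t, (size t < size t01.2)%N /\ take (size t) t01.2 = t &
      forall s s', mkseq s (size t01.1) = t01.1 -> mkseq s' (size t01.2) = t01.2 ->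
        y s <> y s'].
  move=> t; have [It|/split_node[t01 h]] := pselect (I (node t)); last by exists t01.
  by exists ([::], [::]).
pose u := fix u l := if l is b :: l' then
  (if b : bool then (g (u l')).1 else (g (u l')).2) else [::].
have posu l : ~ I (node (u l)).
  elim: l => [|b l IH].
    move=> I1; apply: nP; apply: Isub I1 _ => x [s _ Px]; exists s => //.
  by have [h1 h2 _ _ _] := gP _ IH; case: b.
have su l : (size l <= size (u l))%N.
  elim: l => // b l IH; have [_ _ [h1 _] [h2 _] _] := gP _ (posu l).
  by apply: leq_ltn_trans IH _; case: b.
have tu b l : take (size (u l)) (u (b :: l)) = u l /\
    (size (u l) <= size (u (b :: l)))%N.
  have [_ _ [h1 h1'] [h2 h2'] _] := gP _ (posu l).
  by case: b => /=; split => //; exact: ltnW.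
have size_pre e n : size (pre e n) = n by elim: n => //= n ->.
have nthu e m n i : (m <= n)%N -> (i < size (u (pre e m)))%N ->
    nth 0 (u (pre e n)) i = nth 0 (u (pre e m)) i /\ (i < size (u (pre e n)))%N.
  move=> mn im; elim: n mn => [|n IH]; first by rewrite leqn0 => /eqP <-.
  rewrite leq_eqVlt => /orP[/eqP <-//|]; rewrite ltnS => /IH[{}IH ni].
  have [t1 t2] := tu (e n) (pre e n).
  split; last exact: leq_trans ni t2.
  by rewrite -IH -[in RHS]t1 nth_take.
have lim_u e n : mkseq (lim_scheme u e) (size (u (pre e n))) = u (pre e n).
  apply: (@eq_from_nth _ 0); rewrite size_mkseq// => i ni.
  rewrite nth_mkseq// /lim_scheme.
  have ii : (i < size (u (pre e i.+1)))%N by rewrite -{1}(size_pre e i.+1) su.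
  have [le|/ltnW le] := leqP i.+1 n; first by have [] := nthu e _ _ i le ii.
  by have [] := nthu e _ _ i le ni.
exists u; split; last first.
  move=> e; apply/set0P/eqP => Pe0; have [n nP0] := P0 Pe0.
  apply: (posu (pre e n)); rewrite (_ : node _ = set0)// -subset0 => x [s sn Ps].
  rewrite -(nP0 s)//; apply: agree_le (_ : (n <= size (u (pre e n)))%N) _.
    by rewrite -{1}(size_pre e n) su.
  by apply/agree_mkseq; rewrite lim_u.
move=> e e' yee'; suff ee' n : pre e n = pre e' n.
  by apply/funext => n; have [] := ee' n.+1.
elim: n => //= n IH; rewrite -IH; congr cons; apply: contrapT => en.
have [_ _ _ _ h] := gP _ (posu (pre e n)).
have := lim_u e n.+1; have := lim_u e' n.+1; rewrite /= -IH.
case: (e n) en; case: (e' n) => // _ h1 h2.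
  exact: h h2 h1 yee'.
exact: h h1 h2 (esym yee').
Qed.

End cantor_scheme.

Section four_poles.
Variables (X : topologicalType) (K : (nat -> nat) -> set X) (I : set (set X)).
Hypotheses (uK : usco K) (KT : \bigcup_s K s = setT) (HI : sideal I).
Variable M : (nat -> nat) -> set X.
Hypothesis Mdis : forall c c' x, M c x -> M c' x -> c = c'.
Hypothesis MI : forall c, I (M c).
Hypothesis Minner : forall S : set (nat -> nat), exists B,
  [/\ souslin B, B `<=` \bigcup_(c in S) M c & I (\bigcup_(c in S) M c `\` B)].

Let y (s : nat -> nat) := sel 0 (sel 1 s).
Let e (a : nat -> bool) (x : nat -> bool) := y (lim_scheme (decode_scheme a) x).

(** If the union were positive, a Cantor scheme in a usco subset of it would give an injective [e a]
    with all values in [S]. The work lies in making the label a continuous function of the code. *)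
Let no_scheme_null (S : set (nat -> nat)) :
  (forall a, injective (e a) -> exists x, ~ S (e a x)) -> I (\bigcup_(c in S) M c).
Proof.
have [I0 Isub IU] := HI.
move=> noS; apply: contrapT => nI.
pose St (t : seq nat) := [set c | S c /\ mkseq c (size t) = t].
have /choice[D DP] : forall t, exists D : (nat -> nat) -> set X, [/\ bclosed D,
    forall s, D s `<=` \bigcup_(c in St t) M c &
    I (\bigcup_(c in St t) M c `\` [set x | exists s, D s x])].
  move=> t; have [_ [[D cD ->] BS IB]] := Minner (St t).
  by exists D; split => // s x Ds; apply: BS; exists s.
pose D' s := [set x | forall n, D (mkseq (sel 0 s) n) (sel n.+1 s) x].
have cD' : bclosed D'.
  move=> s x /existsNP[n nD]; have [cD _ _] := DP (mkseq (sel 0 s) n).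
  have [k [U Ux UD]] := cD _ _ nD.
  have [m mP] := agree_sel 0 n; have [m' m'P] := agree_sel n.+1 k.
  exists (maxn m m'), U => // s' x' ss' Ux' /(_ n).
  have /agree_mkseq <- := mP _ _ (agree_le (leq_maxl m m') ss').
  by apply: UD => //; exact: m'P _ _ (agree_le (leq_maxr m m') ss').
pose P s := K (sel 0 s) `&` D' (sel 1 s).
have uP : usco P by exact: usco_bclosedI.
have PM s x : P s x -> S (y s) /\ M (y s) x.
  move=> [_ Ds].
  have h n : exists2 c, M c x & S c /\ mkseq c n = mkseq (y s) n.
    have [_ + _] := DP (mkseq (y s) n).
    by move=> /(_ _ _ (Ds n))[c [Sc]]; rewrite size_mkseq => cn Mc; exists c.
  have [c Mc [Sc _]] := h 0.
  suff -> : y s = c by [].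
  apply: agree_all => n; apply/agree_mkseq.
  by have [c' Mc' [_ <-]] := h n; rewrite (Mdis Mc Mc').
have nIP : ~ I (\bigcup_s P s).
  move=> IP; apply: nI.
  have IN : I (\bigcup_t (\bigcup_(c in St t) M c `\` [set x | exists s, D t s x])).
    by apply: sideal_countType => // t; case: (DP t).
  apply: Isub (sidealU HI IP IN) _ => x [c Sc Mc].
  have [|nx] := pselect ((\bigcup_t (\bigcup_(c in St t) M c `\`
    [set x | exists s, D t s x])) x); first by right.
  left; have /choice[r rP] : forall n, exists r, D (mkseq c n) r x.
    move=> n; apply: contrapT => nr; apply: nx; exists (mkseq c n) => //.
    by split => //; exists c => //; split => //; rewrite size_mkseq.
  have [s _ Ks] : (\bigcup_s K s) x by rewrite KT.
  exists (join (fun i => if i == 0 then s else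
    join (fun j => if j is j'.+1 then r j' else c))) => //.
  by rewrite /P /D' !selK; split => // n /=; rewrite !selK.
have [|n|c|u [uinj uP0]] := @cantor_scheme X I HI P y _ _ nIP _.
- by move=> s; exact: usco_empty.
- have [m mP] := agree_sel 0 n; have [m' m'P] := agree_sel 1 m.
  by exists m' => s s' /m'P/mP.
- by apply: Isub (MI c) _ => x [s <- /PM[]].
have eu : e (encode_scheme u) = (fun x => y (lim_scheme u x)).
  by apply/funext => x; rewrite /e encode_schemeK.
have [|x] := noS (encode_scheme u); first by rewrite eu.
by rewrite eu; have [z /PM[]] := uP0 x.
Qed.

(* A Bernstein set of labels [T] makes both [T] and its complement free of
   images of Cantor schemes. *)
Lemma four_poles : I (\bigcup_c M c).
Proof.
have [I0 Isub IU] := HI.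
have [T TP] := bernstein e.
apply: (Isub _ _ (sidealU HI (no_scheme_null (S := T) _)
  (no_scheme_null (S := ~` T) _))).
- by move=> a /TP[].
- by move=> a /TP[[x Tx] _]; exists x => /(_ Tx).
- by move=> x [c _ Mc]; have [Tc|nTc] := pselect (T c); [left|right]; exists c.
Qed.

End four_poles.

Section stone.
Variables (X : topologicalType) (mul : X -> X -> X) (inv : X -> X) (one : X).
Hypothesis HX : is_topgroup mul inv one.
Local Notation "x * y" := (mul x y).
Local Notation "x ^-1" := (inv x).
Variables (K : (nat -> nat) -> set X) (I : set (set X)).
Hypotheses (uK : usco K) (KT : \bigcup_s K s = setT) (HI : sideal I).
Variables (N : nat -> set X) (B : set X) (l : X -> nat -> nat).
Hypothesis N1 : forall n, N n one.
Hypothesis NN : forall n a b, N n.+1 a -> N n.+1 b -> N n (a * b).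
Hypothesis NV : forall n a, N n a -> N n a^-1.
Hypothesis Ninner : forall (S : set X) n, exists A,
  [/\ souslin A, A `<=` [set x | exists2 s, S s & N n (s^-1 * x)] &
      I ([set x | exists2 s, S s & N n (s^-1 * x)] `\` A)].
Hypothesis NB : N 0 `<=` B.
Hypothesis IB : forall x, I (mul x @` B).
Hypothesis lB : forall x x', l x = l x' -> forall z, B (x^-1 * z) -> B (x'^-1 * z).

(* Stone's sigma-discrete refinement of the cover by the sets [R c], whose
   indices are labels rather than points. *)
Lemma small_balls_null : I [set: X].
Proof.
have [I0 Isub IU] := HI.
have [lt [wf tot]] := wf_total (nat -> nat).
(* The union, over the points [x] labelled [c], of the interiors of [x N_0] with respect to the
   neighbourhoods [N n]. *)
pose R c := [set y | exists x n, l x = c /\ forall w, N n w -> N 0 (x^-1 * y * w)].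
have /choice[m mP] : forall y, exists c, R c y /\ forall c', R c' y -> ~ lt c' c.
  move=> y; have : R (l y) y.
    by exists y, 0; split => // w; rewrite (tgV HX) (tg1 HX).
  elim/(well_founded_ind wf): (l y) => c IH Rc.
  have [[c' [Rc' c'c]]|nc] := pselect (exists c', R c' y /\ lt c' c).
    exact: IH c'c Rc'.
  by exists c; split => // c' Rc' c'c; apply: nc; exists c'.
pose C n := [set y | forall w, N n w -> R (m y) (y * w)].
(* Only centres [y] with [y N_n] inside [R (m y)] are used, [m y] being the least label [c] with [y]
   in [R c], and they are thickened by [N_(n+1)]. If the pieces around two centres meet, each centre
   lies in the other's [R], so by minimality their labels agree. *)
pose M n c := [set z | exists y, [/\ m y = c, C n y & N n.+1 (y^-1 * z)]].
have Nle n : N n.+1 `<=` N n by move=> a Na; rewrite -[a](tgr1 HX); exact: NN.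
have IM n : I (\bigcup_c M n c).
  apply: (four_poles uK KT HI).
  - move=> c c' z [y [yc Cy yz]] [y' [y'c' Cy' y'z]].
    have Ryy' a a' : C n a -> N n.+1 (a^-1 * z) -> N n.+1 (a'^-1 * z) -> R (m a) a'.
      move=> Ca az a'z; have := Ca _ (NN az (NV a'z)).
      by rewrite (tgA HX) (tgVK HX) (tgMV HX) (tgVV HX) (tgVK HX).
    have h1 := (mP y').2 _ (Ryy' _ _ Cy yz y'z).
    have h2 := (mP y).2 _ (Ryy' _ _ Cy' y'z yz).
    by apply: contrapT => /tot[]; rewrite -yc -y'c'.
  - move=> c; have [[x0 lx0]|nx0] := pselect (exists x0, l x0 = c); last first.
      apply: Isub I0 _ => z [y [yc Cy /Nle/Cy]]; rewrite yc => -[x [k [lx _]]].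
      by apply: nx0; exists x.
    (* Different points [x] may witness membership in [R c], but all of them share the label of
       [x0], so the single null translate of [B] by [x0] contains the whole piece. *)
    apply: Isub (IB x0) _ => z [y [yc Cy /Nle/Cy]].
    rewrite yc (tgVK HX) => -[x [k [lx xz]]].
    exists (x0^-1 * z); last by rewrite (tgVK HX).
    apply: (lB (x := x)); first by rewrite lx.
    by apply: NB; rewrite -[_ * z](tgr1 HX); apply: xz.
  - move=> S; suff -> : \bigcup_(c in S) M n c =
        [set x | exists2 s, [set y | S (m y) /\ C n y] s & N n.+1 (s^-1 * x)].
      exact: Ninner.
    apply/esym/seteqP; split.
      by move=> z [y [Sy Cy] yz]; exists (m y) => //; exists y.
    by move=> z [c Sc [y [yc Cy yz]]]; exists y => //; split => //; rewrite yc.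
apply: Isub (IU _ IM) _ => z _.
have [[x [n [lx xz]]] _] := mP z.
exists n.+1 => //; exists (m z) => //; exists z; split => //; last first.
  by rewrite (tgV HX).
move=> w Nw; exists x, n.+1; split => // w' Nw'.
by rewrite -!(tgA HX) (tgA HX); apply: xz; exact: NN.
Qed.

End stone.

(** * Continuity of semimeasurable homomorphisms *)

Section homomorphism.
Variables (X : topologicalType) (mulX : X -> X -> X) (invX : X -> X) (oneX : X).
Variables (Y : topologicalType) (mulY : Y -> Y -> Y) (invY : Y -> Y) (oneY : Y).
Variable I : set (set X).
Hypotheses (HX : is_topgroup mulX invX oneX) (HY : is_topgroup mulY invY oneY).
Variable h : X -> Y.
Hypothesis Hh : group_hom mulX mulY h.

Lemma hom_one : h oneX = oneY.
Proof.
by apply: (tgI HY (x := h oneX)); rewrite -Hh (tg1 HX) (tgr1 HY).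
Qed.

Lemma hom_inv x : h (invX x) = invY (h x).
Proof.
by apply: (tgI HY (x := h x)); rewrite -Hh (tgrV HX) (tgrV HY) hom_one.
Qed.

Lemma nbhs_symmetric_half (U : set Y) : nbhs oneY U -> exists V : set Y,
  [/\ open V, V oneY, forall a, V a -> V (invY a) &
      forall a b, V a -> V b -> U (mulY a b)].
Proof.
move=> U1; have : nbhs (mulY oneY oneY) U by rewrite (tg1 HY).
move=> /(tg_mul_nbhs HY)[V [W [V1 W1 VW]]].
have [G [oG G1] GVW] : exists2 G, open_nbhs oneY G & G `<=` V `&` W.
  have VW1 : nbhs oneY (V `&` W) by exact: filterI.
  by move: VW1; rewrite nbhsE.
exists (G `&` invY @^-1` G); split.
- by apply: openI => //; apply: open_comp => // x _; exact: (tg_continuous_inv HY).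
- by split; rewrite //= /preimage /= (tg1V HY).
- by move=> a [Ga Gia]; split; rewrite //= /preimage /= (tgVV HY).
- move=> a b [/GVW[Va _] _] [/GVW[_ Wb] _]; exact: VW.
Qed.

Hypotheses (Hbaire : baire X) (HKa : K_analytic X).
Hypotheses (HI : sigma_ideal I) (HIinv : left_invariant mulX I).
Hypotheses (HIccc : ccc_ideal I) (HIbase : has_fborel_base I).
Hypothesis HBo : @borel_sets X `<=` gen_with (@fborel_sets X) I.

Lemma sigma_ideal_sideal : sideal I.
Proof.
have [IU Isub Icov _] := HI; split => //.
have [A IA _] : (\bigcup_(A in I) A) oneX by rewrite Icov.
exact: Isub IA (@sub0set _ _).
Qed.

Lemma semimeasurable_preimage_positive (V : set Y) : semimeasurable I h ->
  nbhs oneY V -> ~ I (h @^-1` V).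
Proof.
move=> sh V1 IV; have [_ Isub _ nIT] := HI.
have [K uK KT] : exists2 K : (nat -> nat) -> set X, usco K & \bigcup_s K s = setT.
  by apply: K_analytic_usco; case: HKa.
have [B [[g [B0 [cg bB0 BE]]] IB VB]] := HIbase IV.
have [l lP] := translate_label HX uK KT cg.
have /choice[half halfP] : forall U : set Y, exists V : set Y, nbhs oneY U ->
    [/\ open V, V oneY, forall a, V a -> V (invY a) &
      forall a b, V a -> V b -> U (mulY a b)].
  move=> U; have [/nbhs_symmetric_half[W]|nU] := pselect (nbhs oneY U).
    by exists W.
  by exists setT.
(* The shift by one makes even [W 0] an output of [half], hence open and symmetric. *)
pose W n := iter n.+1 half V.
have W1 n : nbhs oneY (iter n half V).
  elim: n => //= n /halfP[oW W1 _ _]; exact: open_nbhs_nbhs.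
have WP n := halfP _ (W1 n).
apply: nIT; apply: (small_balls_null HX uK KT sigma_ideal_sideal
  (N := fun n => h @^-1` W n) (B := B) (l := l)).
- by move=> n; rewrite /preimage /= hom_one; case: (WP n).
- move=> n a b Wa Wb; rewrite /preimage /= Hh.
  by have [_ _ _] := WP n.+1; exact.
- by move=> n a Wa; rewrite /preimage /= hom_inv; have [_ _ + _] := WP n; exact.
- move=> S n.
  (* The homomorphism turns an arbitrary union of translates into the preimage of one open set, to
     which semimeasurability applies. *)
  have -> : [set x | exists2 s, S s & (h @^-1` W n) (mulX (invX s) x)] =
      h @^-1` (\bigcup_(s in S) [set y | W n (mulY (invY (h s)) y)]).
    by apply/seteqP; split=> x [s Ss Ws]; exists s => //;
      move: Ws; rewrite /preimage /= Hh hom_inv.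
  apply: (semimeasurable_inner_souslin sigma_ideal_sideal HIccc HIbase HKa HBo).
  apply: sh; apply: bigcup_open => s _.
  apply: (@open_comp _ _ (fun y => mulY (invY (h s)) y)) => [y _|].
    exact: (tg_continuous_mulr HY).
  by case: (WP n).
- move=> x Wx; apply: VB; have [_ W01 _ WW] := WP 0.
  by rewrite /preimage /= -[h x](tgr1 HY); exact: WW.
- by move=> x; exact: HIinv.
- by move=> x x' lx z; rewrite BE /preimage /= (lP x x' lx).
Qed.

Lemma semimeasurable_continuous : semimeasurable I h -> continuous h.
Proof.
move=> sh x U Ux.
have hX : hausdorff_space X by case: HKa => -[].
have [K uK KT] : exists2 K : (nat -> nat) -> set X, usco K & \bigcup_s K s = setT.
  by apply: K_analytic_usco; case: HKa.
(* Halved twice, because the elements of [A A^-1 A A^-1] have four factors, each with image in the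
   symmetric [W]. *)
have := tg_nbhs1 HY Ux => /nbhs_symmetric_half[V [oV V1 _ VU]].
have /nbhs_symmetric_half[W [oW W1 WV WW]] : nbhs oneY V by exact: open_nbhs_nbhs.
have nIW := semimeasurable_preimage_positive sh (open_nbhs_nbhs (conj oW W1)).
have [||A [kA AW nA]] := sh W oW setT.
- by case: HKa.
- by rewrite setTI.
have := steinhaus HX uK KT hX Hbaire sigma_ideal_sideal HIccc HIbase HIinv
  (K_analytic_souslin hX kA) nA.
move=> /(tg_nbhs_mul HX x); apply: filterS => z [a [b [c [d [[Aa Ab Ac Ad] xz]]]]].
rewrite /preimage /= -[z](tgVK HX x) xz !Hh !hom_inv.
have {}AW a' : A a' -> W (h a') by move=> /AW[].
by apply: VU; apply: WW; rewrite //; (try apply: WV); exact: AW.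
Qed.

End homomorphism.

Unset Implicit Arguments.

Theorem theorem5p5
  (X : topologicalType) (mulX : X -> X -> X) (invX : X -> X) (oneX : X)
  (Y : topologicalType) (mulY : Y -> Y -> Y) (invY : Y -> Y) (oneY : Y)
  (I : set (set X))
  (HX : is_topgroup mulX invX oneX) (HY : is_topgroup mulY invY oneY)
  (Hbaire : baire X) (HKa : K_analytic X)
  (HI : sigma_ideal I) (HIinv : left_invariant mulX I)
  (HIccc : ccc_ideal I) (HIbase : has_fborel_base I)
  (HBo : @borel_sets X `<=` gen_with (@fborel_sets X) I)
  (h : X -> Y) (Hh : group_hom mulX mulY h) :
  [/\ (continuous h <-> S_measurable (gen_with (@borel_sets X) I) h),
      (continuous h <-> S_measurable (gen_with (@fborel_sets X) I) h) &
      (continuous h <-> semimeasurable I h)].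
Proof.
have c_bo : continuous h -> S_measurable (gen_with (@borel_sets X) I) h.
  move=> ch U oU; apply: sub_sigma_algebra; left; apply: borel_open.
  exact: open_comp.
have bo_ba : S_measurable (gen_with (@borel_sets X) I) h ->
    S_measurable (gen_with (@fborel_sets X) I) h.
  move=> bh U oU; have := bh U oU.
  have : gen_with (@borel_sets X) I `<=` gen_with (@fborel_sets X) I.
    apply: smallest_sub; first exact: smallest_sigma_algebra.
    by move=> A [/HBo//|IA]; apply: sub_sigma_algebra; right.
  exact.
have ba_semi : S_measurable (gen_with (@fborel_sets X) I) h -> semimeasurable I h.
  move=> bh U oU; apply: (gen_with_semimeasurable (sigma_ideal_sideal oneX HI)) => //.
  exact: bh.
have semi_c : semimeasurable I h -> continuous h.
  by apply: (semimeasurable_continuous HX HY Hh).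
by split; split => H; auto.
Qed.
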